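(* Let $p$ be a prime number, let $d$ and $e$ be arbitrary cardinal numbers, and let $\Upsilon\in\{0,1\}$. Then there exists a field $F$ containing a primitive $p$th root of unity $\xi_p$ and a cyclic field extension $K/F$ of degree $p$ with $d(K/F)=d$, $e(K/F)=e$ and $\Upsilon(K/F)=\Upsilon$ if and only if all of the following hold: (1) if $\Upsilon=0$, then $1\le d$; (2) if $p>2$, then $1\le e$; (3) if $p=2$ and $\Upsilon=1$, then $1\le e$.
   Context: For a field $F$ of characteristic not $p$ containing a primitive $p$th root of unity $\xi_p$ and a cyclic extension $K/F$ of degree $p$, with norm map $N=N_{K/F}:K^\times\to F^\times$, the arithmetic invariants are: $d(K/F)=\dim_{\mathbb{F}_p} F^\times/N(K^\times)$; $e(K/F)=\dim_{\mathbb{F}_p} N(K^\times)/F^{\times p}$; and $\Upsilon(K/F)=1$ if $\xi_p\in N(K^\times)$ and $\Upsilon(K/F)=0$ otherwise. Dimensions are cardinal numbers (possibly infinite). *)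

(* Defs.v *)
From HB Require Import structures.
From mathcomp Require Import all_boot all_order all_fingroup all_algebra.
From mathcomp Require Import all_solvable all_field.
From mathcomp Require Import generic_quotient ring_quotient.
From mathcomp Require Import boolp classical_sets functions cardinality.

Set Implicit Arguments.
Unset Strict Implicit.
Unset Printing Implicit Defensive.

Import GRing.Theory.

Local Open Scope ring_scope.

(* A cardinal number is represented by a type [I]: "dim V = |I|" means that V
   has a basis indexed by I. Finite subsets of I are given by injections from
   'I_n, which requires no structure on I. *)
Section Dimension.
Variables (k : fieldType) (V : lmodType k) (I : Type).

Definition lin_indep (b : I -> V) : Prop :=
  forall (n : nat) (s : 'I_n -> I) (c : 'I_n -> k), injective s ->
    \sum_(j < n) c j *: b (s j) = 0 -> forall j, c j = 0.

Definition spanning (b : I -> V) : Prop :=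
  forall v : V, exists (n : nat) (s : 'I_n -> I) (c : 'I_n -> k),
    v = \sum_(j < n) c j *: b (s j).

Definition has_dim : Prop := exists b : I -> V, lin_indep b /\ spanning b.

End Dimension.

(* An abelian group V killed by a prime p, as a vector space over 'F_p. *)
Definition FpMod (p : nat) (p_pr : prime p) (V : zmodType)
  (pV : forall v : V, v *+ p = 0) : Type := V.

Section FpModule.
Variables (p : nat) (p_pr : prime p) (V : zmodType).
Variable pV : forall v : V, v *+ p = 0.
Local Notation M := (FpMod p_pr pV).

HB.instance Definition _ := GRing.Zmodule.on M.

Definition Fp_scale (c : 'F_p) (v : M) : M := v *+ c.

Fact Fp_mulrn_mod n (v : M) : v *+ (n %% (Zp_trunc (pdiv p)).+2) = v *+ n.
Proof.
rewrite Fp_cast //.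
by rewrite [in RHS](divn_eq n p) mulrnDr mulnC mulrnA pV mul0rn add0r.
Qed.

Fact Fp_scaleA a b v : Fp_scale a (Fp_scale b v) = Fp_scale (a * b) v.
Proof. by rewrite /Fp_scale -mulrnA /= Fp_mulrn_mod mulnC. Qed.

Fact Fp_scale1 : left_id 1 Fp_scale.
Proof. by move=> v; rewrite /Fp_scale /= mulr1n. Qed.

Fact Fp_scaleDr : right_distributive Fp_scale +%R.
Proof. by move=> c u v; rewrite /Fp_scale mulrnDl. Qed.

Fact Fp_scaleDl v : {morph Fp_scale^~ v : a b / a + b}.
Proof.
by move=> a b; rewrite /Fp_scale /= Fp_mulrn_mod mulrnDr.
Qed.

HB.instance Definition _ := GRing.Zmodule_isLmodule.Build 'F_p M
  Fp_scaleA Fp_scale1 Fp_scaleDr Fp_scaleDl.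

End FpModule.

(* The multiplicative group of F. Since it is to be quotiented into vector
   spaces its zmodType structure is additive: 0, + and *+ on [units F] are
   1, * and ^+ in F. *)
Record units (F : fieldType) := Units { uval :> F; uval_neq0 : uval != 0 }.

HB.instance Definition _ (F : fieldType) := [isSub for @uval F].
HB.instance Definition _ (F : fieldType) := [Choice of units F by <:].

Section Units.
Variable F : fieldType.
Implicit Types x y z : units F.

Definition uone : units F := Units (oner_neq0 F).
Definition umul x y : units F :=
  Units (mulf_neq0 (uval_neq0 x) (uval_neq0 y)).
Definition uinv x : units F := Units (invr_neq0 (uval_neq0 x)).

Fact umulA : associative umul.
Proof. by move=> x y z; apply: val_inj; rewrite /= mulrA. Qed.

Fact umulC : commutative umul.
Proof. by move=> x y; apply: val_inj; rewrite /= mulrC. Qed.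

Fact umul1 : left_id uone umul.
Proof. by move=> x; apply: val_inj; rewrite /= mul1r. Qed.

Fact umulV : left_inverse uone uinv umul.
Proof. by move=> x; apply: val_inj; rewrite /= mulVf // uval_neq0. Qed.

HB.instance Definition _ := GRing.isZmodule.Build (units F)
  umulA umulC umul1 umulV.

Lemma uval0 : uval (0 : units F) = 1. Proof. by []. Qed.

Lemma uvalD x y : uval (x + y) = uval x * uval y. Proof. by []. Qed.

Lemma uvalN x : uval (- x) = (uval x)^-1. Proof. by []. Qed.

Lemma uvalMn x n : uval (x *+ n) = uval x ^+ n.
Proof. by elim: n => [|n IHn] //; rewrite mulrS exprS uvalD IHn. Qed.

End Units.

Definition cyclic_ext (p : nat) (F : fieldType) (K : splittingFieldType F) :
    Prop :=
  [/\ galois 1 {:K}, cyclic 'Gal({:K} / 1) & \dim {:K} = p].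

Section Norms.
Variables (F : fieldType) (K : splittingFieldType F).

(* N(K^x) as a subgroup of F^x; [x%:A] is the image of x : F in K. *)
Definition norms : {pred units F} := fun x =>
  `[< exists2 a : K, a != 0 & galNorm 1 {:K} a = (uval x)%:A >].

Fact norms_zmod_closed : zmod_closed norms.
Proof.
split=> [|x y /asboolP[a a0 Na] /asboolP[b b0 Nb]]; apply/asboolP.
  by exists 1; rewrite ?oner_neq0 // galNorm1 uval0 scale1r.
exists (a / b); first by rewrite mulf_neq0 // invr_eq0.
rewrite galNormM galNormV Na Nb uvalD uvalN.
by rewrite -!in_algE rmorphM fmorphV.
Qed.

HB.instance Definition _ := GRing.isZmodClosed.Build (units F) norms
  norms_zmod_closed.

Lemma norms_pth_power p (x : units F) : cyclic_ext p K -> x *+ p \in norms.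
Proof.
case=> galK _ dimK; apply/asboolP; exists (uval x)%:A.
  by rewrite -in_algE fmorph_eq0 uval_neq0.
have cardG : #|'Gal({:K} / 1)%g| = p.
  by rewrite -galois_dim // dimv1 divn1.
have -> : galNorm 1 {:K} (uval x)%:A = \prod_(s in 'Gal({:K} / 1)%g) (uval x)%:A.
  by apply: eq_bigr => s sG; rewrite (fixed_gal _ sG) ?sub1v ?rpredZ ?mem1v.
by rewrite prodr_const cardG uvalMn -!in_algE rmorphXn.
Qed.

Record norm_group := NormGroup { nval :> units F; nvalP : nval \in norms }.

HB.instance Definition _ := [isSub for nval].
HB.instance Definition _ := [Choice of norm_group by <:].
HB.instance Definition _ := [SubChoice_isSubZmodule of norm_group by <:].

(* F^(x p) as a subgroup of N(K^x); it is contained in N(K^x) by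
   [norms_pth_power]. *)
Definition pth_powers (p : nat) : {pred norm_group} := fun x =>
  `[< exists y : units F, nval x = y *+ p >].

Fact pth_powers_zmod_closed p : zmod_closed (pth_powers p).
Proof.
split=> [|x y /asboolP[u xu] /asboolP[v yv]]; apply/asboolP.
  by exists 0; rewrite mul0rn.
by exists (u - v); rewrite mulrnBl -xu -yv.
Qed.

HB.instance Definition _ p := GRing.isZmodClosed.Build norm_group (pth_powers p)
  (pth_powers_zmod_closed p).

Fact norm_classes_exp p (v : Quotient.quot norms) :
  cyclic_ext p K -> v *+ p = 0.
Proof.
move=> cK; rewrite -[v]reprK -raddfMn; apply/eqP.
rewrite -(raddf0 (\pi_(Quotient.quot norms))%qT) -Quotient.idealrBE subr0.
exact: norms_pth_power.
Qed.

Fact power_classes_exp p (v : Quotient.quot (pth_powers p)) : v *+ p = 0.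
Proof.
rewrite -[v]reprK -raddfMn; apply/eqP.
rewrite -(raddf0 (\pi_(Quotient.quot (pth_powers p)))%qT).
rewrite -Quotient.idealrBE subr0; apply/asboolP.
by exists (nval (repr v)); rewrite -[nval]/val raddfMn.
Qed.

(* The F_p-vector space F^x / N(K^x), of dimension d(K/F). *)
Definition d_space (p : nat) (p_pr : prime p) (cK : cyclic_ext p K) :
    lmodType 'F_p :=
  FpMod p_pr (fun v : Quotient.quot norms => norm_classes_exp v cK).

(* The F_p-vector space N(K^x) / F^(x p), of dimension e(K/F). *)
Definition e_space (p : nat) (p_pr : prime p) : lmodType 'F_p :=
  FpMod p_pr (@power_classes_exp p).

Definition Upsilon (xi : F) : nat :=
  `[< exists2 a : K, a != 0 & galNorm 1 {:K} a = xi%:A >].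

End Norms.

(* Main.v *)
(* Necessity: if K = F(z) with z^p = a in F, then -z has norm -a.  When -1 is a
   norm, so is a, which is not a p-th power; hence e >= 1.

   Existence: let W be an algebraically closed valued field, L a subfield of units
   and (x_j) a family such that each nontrivial monomial in the x_j is infinite or
   infinitesimal; an ultrapower of the algebraic numbers provides families of any
   size.  Let H be a maximal subfield in which all leading terms are of the form
   l x^n with l in L.  By Hensel's lemma, the p-th power classes of H are those of
   the group of these terms, so that the x_j and a basis of the p-th power classes
   of L form a basis.  For F in H and K = F((-x_0)^(1/p)) the leading term of a
   norm is the norm of a single term c z^i, hence every norm lies in <x_0> H^p.
   Given a family (c_i) in L with c_0 = 0, choose F maximal among the subfields of H
   over which the norms c_i^p + x_0 of the c_i - z are independent modulo p-th
   powers; they generate the elements of F that are p-th powers in H.  These norms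
   then form a basis of N(K^x)/F^(x p), and the elements other than x_0 of the basis
   of H^x/H^(x p) one of F^x/N(K^x).  The value of Upsilon depends on whether xi is
   a p-th power in L or an element of the basis.  For e = 0, hence p = 2, take L
   formally real and Pythagorean and K = H(sqrt -1), whose norms are squares. *)

Require Import Defs.
From HB Require Import structures.
From mathcomp Require Import all_boot all_order all_fingroup all_algebra.
From mathcomp Require Import all_solvable all_field.
From mathcomp Require Import generic_quotient ring_quotient.
From mathcomp Require Import boolp classical_sets functions cardinality filter.
From mathcomp Require Import finmap ring zify.
From mathcomp.multinomials Require Import monalg.

Set Implicit Arguments.
Unset Strict Implicit.
Unset Printing Implicit Defensive.

Import Order.TTheory GRing.Theory Num.Theory.

Local Open Scope ring_scope.

(** * Monomials with integer exponents *)

Section Exponents.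
Variables (I K : choiceType) (f : I -> K).

Definition push_exponents (n : {malg int[I]}) : {malg int[K]} :=
  \sum_(i <- msupp n) << n@_i *g f i >>.

Lemma mcoeff_sum_inj (r : seq I) (e : I -> int) i :
    injective f -> uniq r ->
  (\sum_(j <- r) << e j *g f j >> : {malg int[K]})@_(f i) =
    if i \in r then e i else 0.
Proof.
move=> f_inj r_uniq; rewrite raddf_sum /=.
under eq_bigr do rewrite mcoeffU (inj_eq f_inj).
have [ir|ir] := ifPn.
  rewrite (bigD1_seq i) //= eqxx mulr1n big1 ?addr0 // => j /negPf ->.
  by rewrite mulr0n.
rewrite big_seq big1 // => j jr; case: eqP jr ir => // -> jr.
by rewrite jr.
Qed.

Lemma mcoeff_push n i : injective f -> (push_exponents n)@_(f i) = n@_i.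
Proof. by move=> f_inj; rewrite mcoeff_sum_inj //; case: msuppP. Qed.

Variable g : K -> option I.

Definition pull_exponents (n : {malg int[K]}) : {malg int[I]} :=
  [malg i in [fset i | i in pmap g (msupp n)]%fset => n@_(f i)].

Lemma mcoeff_pull n i : pcancel f g -> (pull_exponents n)@_i = n@_(f i).
Proof.
move=> fK; rewrite mcoeffE in_fset /= mem_pmap; case: mapP => // ni.
apply/esym/eqP; apply: contraT; rewrite mcoeff_neq0 => fi.
by case: ni; exists (f i).
Qed.

End Exponents.

Section Monomial.
Variables (F : fieldType) (I : choiceType) (x : I -> F).
Implicit Types (n : {malg int[I]}) (k : int).

Definition monomial n : F := \prod_(i <- msupp n) x i ^ n@_i.

Lemma monomialEw n (d : {fset I}) :
  (msupp n `<=` d)%fset -> monomial n = \prod_(i <- d) x i ^ n@_i.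
Proof.
by move=> nd; apply: big_fset_incl => // i _ /mcoeff_outdom ->; rewrite expr0z.
Qed.

Lemma monomial0 : monomial 0 = 1.
Proof. by rewrite /monomial msupp0 big_seq_fset0. Qed.

Lemma monomialU k i : monomial << k *g i >> = x i ^ k.
Proof. by rewrite (monomialEw msuppU_le) big_seq_fset1 mcoeffUU. Qed.

Lemma rpred_monomial (S : divClosed F) n :
  (forall i, n@_i != 0 -> x i \in S) -> monomial n \in S.
Proof.
move=> xS; rewrite /monomial big_seq; apply: rpred_prod => i.
by rewrite -mcoeff_neq0 => /xS; apply: rpredXz.
Qed.

Hypothesis x_neq0 : forall i, x i != 0.

Lemma monomial_neq0 n : monomial n != 0.
Proof. by rewrite prodf_seq_neq0; apply/allP => i _; rewrite expfz_neq0. Qed.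

Lemma monomialD n n' : monomial (n + n') = monomial n * monomial n'.
Proof.
rewrite (monomialEw (msuppD_le n n')) (@monomialEw n (msupp n `|` msupp n')%fset).
  rewrite (@monomialEw n' (msupp n `|` msupp n')%fset) ?fsubsetUr // -big_split.
  by apply: eq_bigr => i _; rewrite mcoeffD expfzDr.
exact: fsubsetUl.
Qed.

Lemma monomialN n : monomial (- n) = (monomial n)^-1.
Proof.
by apply: (mulfI (monomial_neq0 n)); rewrite -monomialD subrr monomial0 divff ?monomial_neq0.
Qed.

Lemma monomialB n n' : monomial (n - n') = monomial n / monomial n'.
Proof. by rewrite monomialD monomialN. Qed.

Lemma monomialMn n (k : nat) : monomial (n *+ k) = monomial n ^+ k.
Proof. by elim: k => [|k IH]; rewrite ?monomial0 // mulrS exprS monomialD IH. Qed.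

Lemma monomialMz n k : monomial (n *~ k) = monomial n ^ k.
Proof. by case: k => k; rewrite ?monomialN monomialMn. Qed.

Lemma monomial_sum (T : Type) (r : seq T) (n : T -> {malg int[I]}) :
  monomial (\sum_(t <- r) n t) = \prod_(t <- r) monomial (n t).
Proof.
by elim: r => [|t r IH]; rewrite ?(big_nil, big_cons) ?monomial0 ?monomialD ?IH.
Qed.

End Monomial.

Lemma rmorph_monomial (F F' : fieldType) (f : {rmorphism F -> F'})
    (I : choiceType) (x : I -> F) n :
  f (monomial x n) = monomial (f \o x) n.
Proof. by rewrite /monomial rmorph_prod; apply: eq_bigr => i _; rewrite fmorphXz. Qed.

Lemma monomial_push (F : fieldType) (I K : choiceType) (f : I -> K) (x : K -> F) n :
  (forall i, x i != 0) -> monomial x (push_exponents f n) = monomial (x \o f) n.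
Proof.
move=> x0; rewrite monomial_sum //; apply: eq_bigr => i _.
by rewrite monomialU.
Qed.

(** * Bases of subgroups of a field modulo a smaller subgroup *)

Section PowerClasses.
Variable F : fieldType.
Implicit Types (G N : {pred F}) (p : nat).

Definition powers p G : {pred F} := fun y => `[< exists2 x, x \in G & y = x ^+ p >].

Lemma powersP p G y : reflect (exists2 x, x \in G & y = x ^+ p) (y \in powers p G).
Proof. exact: asboolP. Qed.

Lemma mem_powers p G x : x \in G -> x ^+ p \in powers p G.
Proof. by move=> Gx; apply/powersP; exists x. Qed.

Fact powers_divr_closed p (G : divClosed F) : divr_closed (powers p G).
Proof.
split=> [|_ _ /powersP[x Gx ->] /powersP[y Gy ->]]; apply/powersP.
  by exists 1; rewrite ?rpred1 ?expr1n.
by exists (x / y); rewrite ?rpred_div ?expr_div_n.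
Qed.

HB.instance Definition _ p (G : divClosed F) :=
  GRing.isDivClosed.Build F (powers p G) (powers_divr_closed p G).

Definition indep_mod p N (I : choiceType) (b : I -> F) :=
  forall n : {malg int[I]}, monomial b n \in N -> forall i, (p %| n@_i)%Z.

Definition span_mod N (I : choiceType) (b : I -> F) c :=
  exists n : {malg int[I]}, c / monomial b n \in N.

Definition basis_mod p G N (I : choiceType) (b : I -> F) :=
  [/\ forall i, b i \in G, indep_mod p N b & forall c, c \in G -> span_mod N b c].

Lemma indep_mod_notin p N (I : choiceType) (b : I -> F) i :
  (1 < p)%N -> indep_mod p N b -> b i \notin N.
Proof.
move=> p_gt1 b_indep; apply/negP => Nb.
have := b_indep << 1 *g i >>; rewrite monomialU expr1z => /(_ Nb i).
by rewrite mcoeffUU dvdzE /= dvdn1 => /eqP p1; rewrite p1 in p_gt1.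
Qed.

Lemma basis_mod_bij p G N (I K : choiceType) (b : K -> F) (f : I -> K) :
  0 \notin G -> bijective f -> basis_mod p G N b -> basis_mod p G N (b \o f).
Proof.
move=> G0 f_bij [bG b_indep b_span].
have f_inj := bij_inj f_bij; have [g fK gK] := f_bij.
have b0 k : b k != 0 by apply: contraNneq G0 => <-.
split=> [i|n|c /b_span[n cn]]; first exact: bG.
  rewrite -monomial_push // => /b_indep n_div i.
  by rewrite -(mcoeff_push n i f_inj).
exists (push_exponents g n); rewrite monomial_push => [|i]; last exact: b0.
by rewrite (_ : (b \o f) \o g = b) //; apply/funext => k /=; rewrite gK.
Qed.

End PowerClasses.

Lemma span_mod_finite (F : fieldType) p (L : divClosed F) (I : finType) (b : I -> F) y :
    (0 < p)%N -> (forall i, b i \in L) -> (forall i, b i != 0) ->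
    span_mod (powers p L) b y ->
  exists k : {ffun I -> 'I_p}, exists2 u, u \in L & y = \prod_i b i ^+ k i * u ^+ p.
Proof.
move=> p_gt0 Lb b0 [n /powersP[u Lu yu]].
have mod_lt i : (`|n@_i %% p|%Z < p)%N.
  by rewrite -ltz_nat gez0_abs ?modz_ge0 ?ltz_pmod // -lt0n.
exists [ffun i => Ordinal (mod_lt i)], (u * \prod_i b i ^ (n@_i %/ p)%Z).
  by rewrite rpredM // rpred_prod // => i _; rewrite rpredXz.
rewrite -(divfK (monomial_neq0 b0 n) y) yu exprMn mulrCA; congr (_ * _).
rewrite /monomial big_uniq ?fset_uniq // big_mkcond -prodrXl -big_split.
apply: eq_bigr => i _; rewrite ffunE /= !exprnP gez0_abs ?modz_ge0 // ?exprz_exp -?lt0n //.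
rewrite -expfzDr // addrC -divz_eq.
by case: ifPn => // /mcoeff_outdom ->; rewrite expr0z.
Qed.

Section SumExponents.
Variables (F : fieldType) (I J : choiceType) (b : I + J -> F).
Hypothesis b_neq0 : forall i, b i != 0.

Definition left_exponents : {malg int[(I + J)%type]} -> {malg int[I]} :=
  pull_exponents inl (fun s => if s is inl i then Some i else None).

Definition right_exponents : {malg int[(I + J)%type]} -> {malg int[J]} :=
  pull_exponents inr (fun s => if s is inr j then Some j else None).

Lemma mcoeff_left n i : (left_exponents n)@_i = n@_(inl i).
Proof. exact: mcoeff_pull. Qed.

Lemma mcoeff_right n j : (right_exponents n)@_j = n@_(inr j).
Proof. exact: mcoeff_pull. Qed.

Lemma monomial_sum_type n :
  monomial b n = monomial (b \o inl) (left_exponents n) *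
                 monomial (b \o inr) (right_exponents n).
Proof.
have inl_inj : injective (@inl I J) by move=> i i' [].
have inr_inj : injective (@inr I J) by move=> j j' [].
rewrite -(monomial_push inl) // -(monomial_push inr) // -monomialD //.
congr (monomial b _).
apply/malgP => -[i|j]; rewrite mcoeffD.
  rewrite mcoeff_push // mcoeff_left raddf_sum /= big1 ?addr0 // => j _.
  by rewrite mcoeffU.
rewrite mcoeff_push // mcoeff_right raddf_sum /= big1 ?add0r // => i _.
by rewrite mcoeffU.
Qed.

End SumExponents.

(** * Dimensions of the spaces of classes *)

Lemma quot_has_dim (p : nat) (p_pr : prime p) (V : zmodType) (S : zmodClosed V)
    (pV : forall v : Quotient.quot S, v *+ p = 0) (I : Type) (b : I -> V) :
    (forall n (s : 'I_n -> I) (e : 'I_n -> int), injective s ->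
       \sum_(j < n) b (s j) *~ e j \in S -> forall j, (p %| e j)%Z) ->
    (forall v, exists n (s : 'I_n -> I) (e : 'I_n -> int),
       v - \sum_(j < n) b (s j) *~ e j \in S) ->
  has_dim (FpMod p_pr pV) I.
Proof.
move=> b_indep b_span; pose b' i : FpMod p_pr pV := \pi_(Quotient.quot S)%qT (b i).
have pi_sum n (s : 'I_n -> I) (e : 'I_n -> int) :
    \sum_(j < n) b' (s j) *~ e j =
    \pi_(Quotient.quot S)%qT (\sum_(j < n) b (s j) *~ e j).
  by rewrite raddf_sum; apply: eq_bigr => j _; rewrite raddfMz.
exists b'; split=> [n s c s_inj cb j|v].
  have : (p %| (c j : nat)%:Z)%Z.
    apply: (b_indep n s (fun j => (c j : nat)%:Z)) => //.
    have := pi_sum n s (fun j => (c j : nat)%:Z).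
    rewrite [LHS](_ : _ = 0); last by rewrite -[RHS]cb; apply: eq_bigr.
    move=> /esym/eqP; rewrite -(raddf0 (\pi_(Quotient.quot S))%qT).
    by rewrite -Quotient.idealrBE subr0.
  rewrite dvdzE /= => p_cj; apply/val_inj/eqP; rewrite -leqn0 leqNgt.
  apply: contraL p_cj => cj0; rewrite gtnNdvd //.
  by have := ltn_ord (c j); rewrite {2}Fp_cast.
have [n [s [e ve]]] := b_span (repr v); exists n, s, (fun j => (e j)%:~R).
under eq_bigr do rewrite scaler_int.
by rewrite pi_sum -[LHS]reprK; apply/eqP; rewrite -Quotient.idealrBE.
Qed.

Section FamilyMonomial.
Variables (F : fieldType) (I : choiceType) (b : I -> F).

Lemma monomial_family n (s : 'I_n -> I) (e : 'I_n -> int) :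
  (forall i, b i != 0) ->
  monomial b (\sum_j << e j *g s j >>) = \prod_j b (s j) ^ e j.
Proof.
by move=> b0; rewrite monomial_sum //; apply: eq_bigr => j _; rewrite monomialU.
Qed.

Lemma monomial_as_family (m : {malg int[I]}) :
  exists n (s : 'I_n -> I) (e : 'I_n -> int),
    monomial b m = \prod_(j < n) b (s j) ^ e j.
Proof. by do 3 eexists; exact: big_tnth. Qed.

Lemma indep_mod_family p (N : {pred F}) n (s : 'I_n -> I) (e : 'I_n -> int) :
  (forall i, b i != 0) -> indep_mod p N b -> injective s ->
  \prod_j b (s j) ^ e j \in N -> forall j, (p %| e j)%Z.
Proof.
move=> b0 b_indep s_inj; rewrite -monomial_family // => /b_indep e_div j.
suff <- : (\sum_j << e j *g s j >> : {malg int[I]})@_(s j) = e j by apply: e_div.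
rewrite raddf_sum /= (bigD1 j) //= mcoeffUU big1 ?addr0 // => i ij.
by rewrite mcoeffU (inj_eq s_inj) (negPf ij).
Qed.

End FamilyMonomial.

Lemma uval_lincomb (F : fieldType) (I : Type) (u : I -> units F) n (s : 'I_n -> I)
    (e : 'I_n -> int) :
  uval (\sum_j u (s j) *~ e j) = \prod_j uval (u (s j)) ^ e j.
Proof.
rewrite (big_morph _ (@uvalD F) (@uval0 F)); apply: eq_bigr => j _.
by case: (e j) => k; rewrite ?uvalN uvalMn.
Qed.

Section NormImage.
Variables (F : fieldType) (K : splittingFieldType F).

Definition norm_image : {pred F} :=
  fun c => `[< exists2 w : K, w != 0 & galNorm 1 {:K} w = c%:A >].

Lemma norm_imageP c :
  reflect (exists2 w : K, w != 0 & galNorm 1 {:K} w = c%:A) (c \in norm_image).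
Proof. exact: asboolP. Qed.

Fact norm_image_divr_closed : divr_closed norm_image.
Proof.
split=> [|c c' /norm_imageP[w w0 Nw] /norm_imageP[w' w'0 Nw']]; apply/norm_imageP.
  by exists 1; rewrite ?oner_neq0 // galNorm1 scale1r.
exists (w / w'); first by rewrite mulf_neq0 ?invr_eq0.
by rewrite galNormM galNormV Nw Nw' -!in_algE fmorph_div.
Qed.

HB.instance Definition _ :=
  GRing.isDivClosed.Build F norm_image norm_image_divr_closed.

Lemma norm_image_neq0 c : c \in norm_image -> c != 0.
Proof.
move=> /norm_imageP[w w0 Nw]; apply: contraNneq w0 => c0.
by rewrite -(galNorm_eq0 1 {:K}) Nw c0 scale0r.
Qed.

Lemma mem_norms (u : units F) : (u \in norms K) = (uval u \in norm_image).
Proof. by []. Qed.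

Lemma UpsilonE xi : Upsilon K xi = (xi \in norm_image). Proof. by []. Qed.

Variables (p : nat) (p_pr : prime p).

Lemma d_space_dim (cK : cyclic_ext p K) (D : choiceType) (b : D -> F) :
  basis_mod p (predC1 0) norm_image b -> has_dim (d_space p_pr cK) D.
Proof.
move=> [b0 b_indep b_span]; pose u d : units F := Units (b0 d).
apply: (@quot_has_dim _ p_pr _ _ _ _ u) => [n s e s_inj|v].
  by rewrite mem_norms uval_lincomb; exact: indep_mod_family b0 b_indep s_inj.
have [m] := b_span _ (uval_neq0 v); have [n [s [e ->]]] := monomial_as_family b m.
by exists n, s, e; rewrite mem_norms uvalD uvalN uval_lincomb.
Qed.

Lemma e_space_dim (E : choiceType) (t : E -> F) :
  basis_mod p norm_image (powers p predT) t -> has_dim (e_space K p_pr) E.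
Proof.
move=> [tN t_indep t_span]; have t0 i := norm_image_neq0 (tN i).
have uN i : (Units (t0 i) : units F) \in norms K by rewrite mem_norms; exact: tN.
pose u i : norm_group K := NormGroup (uN i).
have nval_lincomb n (s : 'I_n -> E) (e : 'I_n -> int) :
    uval (nval (\sum_j u (s j) *~ e j)) = \prod_j t (s j) ^ e j.
  rewrite -(uval_lincomb (fun i => Units (t0 i))); congr uval.
  rewrite [LHS](raddf_sum (val : norm_group K -> units F)); apply: eq_bigr => j _.
  exact: (raddfMz (val : norm_group K -> units F)).
apply: (@quot_has_dim _ p_pr _ _ _ _ u) => [n s e s_inj /asboolP[y ue]|v].
  apply: (indep_mod_family (N := powers p predT) t0 t_indep s_inj).
  by rewrite -nval_lincomb ue uvalMn mem_powers.
have [m /powersP[f _ vf]] := t_span _ (nvalP v).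
have [n [s [e me]]] := monomial_as_family t m.
have vf0 : f ^+ p != 0.
  by rewrite -vf mulf_neq0 ?invr_eq0 ?monomial_neq0 ?uval_neq0.
have f0 : f != 0 by move: vf0; rewrite expf_eq0 prime_gt0.
exists n, s, e; apply/asboolP; exists (Units f0); apply: val_inj => /=.
rewrite uvalMn -vf me -nval_lincomb.
by rewrite -uvalN -uvalD; congr uval; exact: (raddfB (val : norm_group K -> units F)).
Qed.

End NormImage.

(** * Subfields of a field *)

Section SubfieldType.
Variables (W : fieldType) (F : divringClosed W).

Record subfield_type := Subfield { subfield_val :> W; subfield_valP : subfield_val \in F }.

HB.instance Definition _ := [isSub for subfield_val].
HB.instance Definition _ := [Choice of subfield_type by <:].
HB.instance Definition _ := [SubChoice_isSubIntegralDomain of subfield_type by <:].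
HB.instance Definition _ := [SubIntegralDomain_isSubField of subfield_type by <:].

Lemma polyOver_subfield (f : {poly W}) : f \is a polyOver F ->
  exists g : {poly subfield_type}, f = map_poly (val : subfield_type -> W) g.
Proof.
move=> /polyOverP Ff; exists (\poly_(i < size f) Subfield (Ff i)).
apply/polyP => i; rewrite coef_map coef_poly /=.
by case: ltnP => //= h; rewrite nth_default.
Qed.

Lemma polyOver_modp (f g : {poly W}) :
  f \is a polyOver F -> g \is a polyOver F -> f %% g \is a polyOver F.
Proof.
move=> /polyOver_subfield[f' ->] /polyOver_subfield[g' ->].
by rewrite -map_modp; apply/polyOverP => i; rewrite coef_map /= subfield_valP.
Qed.

Definition inclusion : {rmorphism subfield_type -> W} := (val : subfield_type -> W).

Lemma mem_inclusion y : inclusion y \in F. Proof. exact: subfield_valP. Qed.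

Lemma powers_inclusion p y : (inclusion y \in powers p F) = (y \in powers p predT).
Proof.
apply/powersP/powersP => -[x Fx yx].
  by exists (Subfield Fx) => //; apply: val_inj; rewrite [val _]yx [in RHS](rmorphXn inclusion).
by exists (inclusion x); rewrite ?mem_inclusion // yx rmorphXn.
Qed.

Lemma indep_mod_inclusion p (I : choiceType) (b : I -> subfield_type) :
  indep_mod p (powers p F) (inclusion \o b) -> indep_mod p (powers p predT) b.
Proof. by move=> b_indep n; rewrite -powers_inclusion rmorph_monomial => /b_indep. Qed.

Lemma span_mod_inclusion p (I : choiceType) (b : I -> subfield_type) y :
  span_mod (powers p F) (inclusion \o b) (inclusion y) -> span_mod (powers p predT) b y.
Proof.
by move=> [n yn]; exists n; rewrite -powers_inclusion fmorph_div rmorph_monomial.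
Qed.

End SubfieldType.

Section Subfields.
Variable W : fieldType.
Implicit Types (F G : divringClosed W) (x y r : W).

Definition adjoin F r : {pred W} := fun x => `[< exists f g,
  [/\ f \is a polyOver F, g \is a polyOver F, g.[r] != 0 & x = f.[r] / g.[r]] >].

Lemma adjoinP F r x : reflect (exists f g,
  [/\ f \is a polyOver F, g \is a polyOver F, g.[r] != 0 & x = f.[r] / g.[r]])
  (x \in adjoin F r).
Proof. exact: asboolP. Qed.

Fact adjoin_divring_closed F r : divring_closed (adjoin F r).
Proof.
split.
- by apply/adjoinP; exists 1, 1; rewrite rpred1 hornerC oner_eq0 divr1.
- move=> _ _ /adjoinP[f [g [Ff Fg g0 ->]]] /adjoinP[f' [g' [Ff' Fg' g'0 ->]]].
  apply/adjoinP; exists (f * g' - f' * g), (g * g').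
  by rewrite rpredB ?rpredM // !hornerE mulf_neq0 // -mulNr addf_div // mulNr.
- move=> _ _ /adjoinP[f [g [Ff Fg g0 ->]]] /adjoinP[f' [g' [Ff' Fg' g'0 ->]]].
  apply/adjoinP; have [f'0|f'0] := eqVneq f'.[r] 0.
    by exists 0, 1; rewrite rpred0 rpred1 !hornerE oner_eq0 f'0 !(mul0r, invr0, mulr0).
  exists (f * g'), (g * f').
  by rewrite !rpredM // !hornerM mulf_neq0 // invf_div mulf_div.
Qed.

HB.instance Definition _ F r :=
  GRing.isDivringClosed.Build W (adjoin F r) (adjoin_divring_closed F r).

Lemma sub_adjoin F r : {subset F <= adjoin F r}.
Proof.
move=> x Fx; apply/adjoinP; exists x%:P, 1.
by rewrite polyOverC rpred1 !hornerC oner_eq0 divr1.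
Qed.

Lemma mem_adjoin F r : r \in adjoin F r.
Proof.
apply/adjoinP; exists 'X, 1.
by rewrite polyOverX rpred1 hornerC hornerX oner_eq0 divr1.
Qed.

Lemma adjoin_min F G r :
  {subset F <= G} -> r \in G -> {subset adjoin F r <= G}.
Proof.
move=> FG Gr _ /adjoinP[f [g [/(polyOverS FG) Gf /(polyOverS FG) Gg _ ->]]].
by rewrite rpred_div ?rpred_horner.
Qed.

Definition subfield_of (S : pred W) (S_closed : divring_closed S) : divringClosed W :=
  HB.pack S (GRing.isDivringClosed.Build W S S_closed).

Lemma chain_union_divring_closed (C : divringClosed W -> Prop) F0 : C F0 ->
  (forall F G, C F -> C G -> {subset F <= G} \/ {subset G <= F}) ->
  divring_closed [pred x | `[< exists2 F, C F & x \in F >]].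
Proof.
move=> CF0 C_total; have common x y :
    (exists2 F, C F & x \in F) -> (exists2 F, C F & y \in F) ->
    exists F, [/\ C F, x \in F & y \in F].
  move=> [F CF Fx] [G CG Gy].
  by have [s|s] := C_total _ _ CF CG; [exists G|exists F]; split => //; apply: s.
split=> [|x y /asboolP Cx /asboolP Cy|x y /asboolP Cx /asboolP Cy]; apply/asboolP.
- by exists F0; rewrite ?rpred1.
- by have [F [CF Fx Fy]] := common _ _ Cx Cy; exists F; rewrite ?rpredB.
- by have [F [CF Fx Fy]] := common _ _ Cx Cy; exists F; rewrite ?rpred_div.
Qed.

Lemma subfield_Zorn (R : divringClosed W -> W -> Prop) F0 :
    (forall F G x, {subset F <= G} -> R F x -> R G x) ->
    (forall x, x \in F0 -> R F0 x) ->
  exists F, [/\ {subset F0 <= F}, forall x, x \in F -> R F x &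
    forall G, {subset F <= G} -> (forall x, x \in G -> R G x) -> {subset G <= F}].
Proof.
move=> R_mono RF0.
pose good F := {subset F0 <= F} /\ forall x, x \in F -> R F x.
pose P : set (set W) := fun A => A = set0 \/ exists2 F, good F & A = [set` F]%classic.
have [C CP C_total|A [PA maxA]] := @Zorn_bigcup W P.
  pose fields F := good F /\ C [set` F]%classic.
  have [[F [gF CF]]|no_field] := pselect (exists F, fields F); last first.
    left; apply/seteqP; split=> // x [A CA Ax].
    have [A0|[F gF AF]] := CP A CA; first by rewrite A0 in Ax.
    by case: no_field; exists F; rewrite /fields -AF.
  have fields_total F1 F2 : fields F1 -> fields F2 ->
      {subset F1 <= F2} \/ {subset F2 <= F1}.
    move=> [_ C1] [_ C2].
    by have [sub|sub] := C_total _ _ C1 C2; [left|right] => x /sub.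
  have U_closed : divring_closed [pred x | `[< exists2 F, fields F & x \in F >]].
    by apply: (chain_union_divring_closed (F0 := F)).
  pose U := subfield_of U_closed.
  have FU F' : fields F' -> {subset F' <= U} by move=> ? x ?; apply/asboolP; exists F'.
  right; exists U.
    split=> [x F0x|x /asboolP[F' fF' F'x]]; last first.
      by apply: (R_mono F'); [exact: FU | exact: fF'.1.2].
    by apply: (FU F) => //; exact: gF.1.
  apply/seteqP; split=> [x [A CA Ax]|x /asboolP[F' [gF' CF'] F'x]]; last first.
    by exists [set` F']%classic.
  have [A0|[F' gF' AF']] := CP A CA; first by rewrite A0 in Ax.
  by apply/asboolP; exists F'; [split; rewrite -?AF' | rewrite AF' in Ax].
case: PA => [A0|[F [F0F RF] AF]].
  case: (maxA [set` F0]%classic); last by right; exists F0 => //; split.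
  by rewrite A0; split=> [x //|/(_ 1 (rpred1 F0))].
exists F; split=> // G FG RG x Gx; apply: contrapT => Fx; case: (maxA [set` G]%classic).
  by rewrite AF; split=> [y /FG|/(_ x Gx)].
by right; exists G => //; split=> // y /F0F /FG.
Qed.

End Subfields.

(** * Kummer theory *)

Lemma binomial_factor (F : fieldType) p (xi y : F) :
  p.-primitive_root xi -> y != 0 ->
  'X^p - (y ^+ p)%:P = \prod_(0 <= i < p) ('X - (xi ^+ i * y)%:P).
Proof.
move=> xiP y0; have p_gt0 := prim_order_gt0 xiP.
rewrite -(big_map (fun i => xi ^+ i * y) xpredT (fun r => 'X - r%:P)).
rewrite [LHS](@all_roots_prod_XsubC _ _ [seq xi ^+ i * y | i <- index_iota 0 p]).
- by rewrite (monicP (monicXnsubC _ p_gt0)) scale1r.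
- by rewrite size_XnsubC // size_map size_iota subn0.
- apply/allP => _ /mapP[i _ ->]; rewrite rootE !hornerE exprMn exprAC.
  by rewrite (prim_expr_order xiP) expr1n mul1r subrr.
- rewrite uniq_rootsE map_inj_in_uniq ?iota_uniq // => i j.
  rewrite !mem_index_iota /= => ip jp /(mulIf y0)/eqP.
  by rewrite (eq_prim_root_expr xiP) !modn_small // => /eqP.
Qed.

Lemma eq_exp_prim_root (F : fieldType) p (xi y w : F) :
  p.-primitive_root xi -> w ^+ p = y ^+ p -> exists k : nat, w = xi ^+ k * y.
Proof.
move=> xiP wy; have p_gt0 := prim_order_gt0 xiP.
have [y0|y0] := eqVneq y 0.
  exists 0%N; move/eqP: wy; rewrite y0 expr0n gtn_eqF // expf_eq0 p_gt0 => /eqP ->.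
  by rewrite mulr0.
have /(prim_rootP xiP)[k wk] : (w / y) ^+ p = 1 by rewrite expr_div_n wy divff // expf_neq0.
by exists k; rewrite -wk divfK.
Qed.

Lemma coprime_expz (F : fieldType) (m n : nat) : coprime m n ->
  exists u v : int, forall y : F, y != 0 -> (y ^+ m) ^ u * (y ^+ n) ^ v = y.
Proof.
move=> /eqP mn; have [u [v uv]] := Bezoutz m%:Z n%:Z.
exists u, v => y y0; rewrite !exprnP !exprz_exp -expfzDr // mulrC [n%:Z * v]mulrC.
by rewrite uv /gcdz /= mn expr1z.
Qed.

Lemma prime_coprime_mod p m : prime p -> ~~ (p %| m)%N -> coprime m p.
Proof. by move=> p_pr; rewrite coprime_sym prime_coprime. Qed.

Lemma indep_mod_unit (F : fieldType) p (N : divClosed F) (y : F) :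
  prime p -> y != 0 -> y ^+ p \in N -> y \notin N -> indep_mod p N (fun _ : unit => y).
Proof.
move=> p_pr y0 Nyp Ny n; rewrite (_ : n = << n@_tt *g tt >>); last first.
  by apply/malgP => -[]; rewrite mcoeffUU.
rewrite monomialU => Nyn []; rewrite mcoeffUU dvdzE; apply: contraT.
move=> /(prime_coprime_mod p_pr)/(coprime_expz F)[u [v uv]].
case/negP: Ny; rewrite -(uv y y0) rpredM ?rpredXz //.
by case: (n@_tt) Nyn => k // ; rewrite NegzE -invr_expz rpredV.
Qed.

Section KummerExtension.
Variables (F W : fieldType) (iota : {rmorphism F -> W}) (p : nat) (xi a : F) (alpha : W).
Hypotheses (p_pr : prime p) (xiP : p.-primitive_root xi).
Hypotheses (a_npow : a \notin powers p predT) (alphaP : alpha ^+ p = iota a).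

Let p_gt0 : (0 < p)%N := prime_gt0 p_pr.
Let P : {poly F} := 'X^p - a%:P.

Let map_P (K : fieldType) (f : {rmorphism F -> K}) : map_poly f P = 'X^p - (f a)%:P.
Proof. by rewrite rmorphB /= map_polyXn map_polyC. Qed.

Let a_neq0 : a != 0.
Proof.
apply: contraNneq a_npow => ->; apply/powersP.
by exists 0; rewrite ?expr0n ?gtn_eqF.
Qed.

Let alpha_neq0 : alpha != 0.
Proof.
apply: contraNneq a_neq0 => alpha0; rewrite -(fmorph_eq0 iota) -alphaP alpha0.
by rewrite expr0n gtn_eqF.
Qed.

Let root_P : root (map_poly iota P) alpha.
Proof. by rewrite map_P rootE !hornerE alphaP subrr. Qed.

Let P_neq0 : P != 0. Proof. by rewrite monic_neq0 ?monicXnsubC. Qed.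

Lemma alpha_exp_notin d c : (0 < d < p)%N -> alpha ^+ d != iota c.
Proof.
move=> /andP[d0 dp]; apply: contraNneq a_npow => alpha_d; apply/powersP.
have [|u [v uv]] := coprime_expz W (m := d) (n := p).
  by rewrite prime_coprime_mod ?gtnNdvd.
exists (c ^ u * a ^ v) => //; apply: (fmorph_inj iota).
by rewrite rmorphXn rmorphM !fmorphXz -alpha_d -alphaP uv.
Qed.

(* A divisor of 'X^p - a is a product of factors 'X - xi^i * alpha. *)
Lemma monic_divisor_binomial (g : {poly F}) :
  g \is monic -> g %| P -> exists c, alpha ^+ (size g).-1 = iota c.
Proof.
move=> g_monic; rewrite -(dvdp_map iota) map_P -alphaP.
have iota_xiP : p.-primitive_root (iota xi) by rewrite fmorph_primitive_root.
rewrite (binomial_factor iota_xiP alpha_neq0) => /dvdp_prod_XsubC[msk].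
set s := mask msk _; rewrite eqp_monic ?monic_prod_XsubC ?map_monic // => /eqP gE.
have -> : (size g).-1 = size s by rewrite -(size_map_poly iota) gE size_prod_XsubC.
pose u := \prod_(i <- s) - xi ^+ i.
have u0 : u != 0.
  rewrite prodf_seq_neq0; apply/allP => i _.
  by rewrite oppr_eq0 expf_neq0 // (prim_root_eq0 xiP) -lt0n.
exists (g.[0] / u); rewrite fmorph_div -horner_map rmorph0 gE horner_prod.
under eq_bigr do rewrite !hornerE -mulNr -rmorphXn -rmorphN.
rewrite big_split /= -rmorph_prod big_const_seq count_predT iter_mulr_1.
by rewrite mulrAC divff ?mul1r // fmorph_eq0.
Qed.

Lemma root_binomial_size (q : {poly F}) :
  q != 0 -> root (map_poly iota q) alpha -> (p < size q)%N.
Proof.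
move=> q0 q_alpha; rewrite ltnNge; apply/negP => q_size.
have g0 : gcdp q P != 0 by rewrite gcdp_eq0 negb_and q0.
have lc0 : (lead_coef (gcdp q P))^-1 != 0 by rewrite invr_eq0 lead_coef_eq0.
pose g := (lead_coef (gcdp q P))^-1 *: gcdp q P.
have g_monic : g \is monic by rewrite monicE lead_coefZ mulVf // lead_coef_eq0.
have g_dvd : g %| P by rewrite dvdpZl // dvdp_gcdr.
have g_size : (size g <= p)%N by rewrite size_scale // (leq_trans (leq_gcdpl _ q0)).
have : root (map_poly iota g) alpha.
  by rewrite map_polyZ rootZ ?fmorph_eq0 // gcdp_map root_gcd q_alpha.
have [c alpha_exp] := monic_divisor_binomial g_monic g_dvd.
have g'0 : map_poly iota g != 0 by rewrite map_poly_eq0 monic_neq0.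
move=> /(root_size_gt1 g'0); rewrite size_map_poly => g_gt1.
have /(alpha_exp_notin c)/eqP[//] : (0 < (size g).-1 < p)%N.
by case: (size g) g_gt1 g_size => // k; rewrite ltnS => ->.
Qed.

Lemma binomial_irreducible : irreducible_poly P.
Proof.
apply/(subfx_irreducibleP root_P P_neq0) => q q_alpha q0.
by rewrite size_XnsubC //; exact: root_binomial_size.
Qed.

Let K0 : fieldExtType F := SubFieldExtType root_P binomial_irreducible.
Let j0 : {rmorphism K0 -> W} := subfx_inj.
Let z0 : K0 := subfx_root iota alpha P.

Let j0_z0 : j0 z0 = alpha.
Proof. exact: (subfx_inj_root root_P P_neq0). Qed.

Let j0_alg c : j0 c%:A = iota c.
Proof. exact: (subfx_inj_base root_P P_neq0). Qed.

Let z0_exp : z0 ^+ p = a%:A.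
Proof. by apply: (fmorph_inj j0); rewrite rmorphXn /= j0_z0 j0_alg alphaP. Qed.

Let K0_poly (w : K0) :
  exists2 q : {poly F}, (size q <= p)%N & w = (map_poly (in_alg K0) q).[z0].
Proof.
have [q ->] := subfxEroot root_P P_neq0 w; exists (q %% P).
  by have := ltn_modpN0 q P_neq0; rewrite size_XnsubC.
rewrite [in LHS](divp_eq q P) rmorphD rmorphM /= hornerD hornerM.
by rewrite map_P !hornerE z0_exp /= subrr mulr0 add0r.
Qed.

Let rs := [seq (xi%:A : K0) ^+ i * z0 | i <- index_iota 0 p].

Let P_split : map_poly (in_alg K0) P = \prod_(r <- rs) ('X - r%:P).
Proof.
rewrite map_P /= -z0_exp (@binomial_factor _ _ (xi%:A : K0)) ?big_map //.
  by rewrite -in_algE fmorph_primitive_root.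
by rewrite -(fmorph_eq0 j0) j0_z0.
Qed.

Let rs_uniq : uniq rs.
Proof.
have xiKP : p.-primitive_root (xi%:A : K0) by rewrite -in_algE fmorph_primitive_root.
have z0_neq0 : z0 != 0 by rewrite -(fmorph_eq0 j0) j0_z0.
rewrite map_inj_in_uniq ?iota_uniq // => i k.
rewrite !mem_index_iota /= => ip kp /(mulIf z0_neq0)/eqP.
by rewrite (eq_prim_root_expr xiKP) !modn_small // => /eqP.
Qed.

Let P_splitting : splittingFieldFor 1 (map_poly (in_alg K0) P) {:K0}.
Proof.
exists rs; first by rewrite P_split eqpxx.
apply/eqP; rewrite eqEsubv subvf; apply/subvP => w _; have [q _ ->] := K0_poly w.
have sub : (<<1; z0>> <= <<1 & rs>>)%VS.
  apply/FadjoinP; split; first exact: subv_adjoin_seq.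
  apply: seqv_sub_adjoin; apply/mapP; exists 0%N; rewrite ?expr0 ?mul1r //.
  by rewrite mem_index_iota.
by apply: (subvP sub); apply/Fadjoin1_polyP; exists q.
Qed.

Let K0_axiom : splitting_field_axiom K0.
Proof.
by exists (map_poly (in_alg K0) P); [exact: alg_polyOver | exact: P_splitting].
Qed.

Let K1 : splittingFieldType F :=
  HB.pack K0 (FieldExt_isSplittingField.Build F K0 K0_axiom).

Lemma Kummer_extension :
  exists (K : splittingFieldType F) (z : K) (j : {rmorphism K -> W}),
  [/\ cyclic_ext p K, z ^+ p = a%:A, j z = alpha, forall c : F, j c%:A = iota c &
    forall w : K,
      exists2 q : {poly F}, (size q <= p)%N & w = (map_poly (in_alg K) q).[z]].
Proof.
exists K1, z0, j0; split=> //.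
have galK : galois 1 {:K1}.
  apply/splitting_galoisField; exists (map_poly (in_alg K0) P); split.
  - exact: alg_polyOver.
  - by rewrite P_split separable_prod_XsubC.
  - exact: P_splitting.
have dimK : \dim {:K1} = p.
  by rewrite dimvf -[RHS]/(p.+1.-1) -(size_XnsubC a p_gt0).
split=> //; apply: prime_cyclic.
by rewrite -galois_dim // dimv1 divn1 dimK.
Qed.

End KummerExtension.

Lemma pth_root_notin (F : fieldType) (K : splittingFieldType F) p (a : F) (z : K) :
  a \notin powers p predT -> z ^+ p = a%:A -> z \notin 1%VS.
Proof.
move=> a_npow zp; apply: contra a_npow => /vlineP[y zy]; apply/powersP; exists y => //.
by apply: (fmorph_inj (in_alg K)); rewrite rmorphXn /= -zy zp.
Qed.

Section KummerNorm.
Variables (F : fieldType) (K : splittingFieldType F) (p : nat) (xi a : F) (z : K).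
Hypotheses (p_pr : prime p) (xiP : p.-primitive_root xi) (cK : cyclic_ext p K).
Implicit Type s : gal_of {:K}.

Let p_gt0 : (0 < p)%N := prime_gt0 p_pr.

Lemma card_gal_cyclic_ext : #|'Gal({:K} / 1)%g| = p.
Proof. by case: cK => galK _ dimK; rewrite -galois_dim // dimv1 divn1. Qed.

Lemma gal_alg s (c : F) : s \in 'Gal({:K} / 1)%g -> s c%:A = c%:A.
Proof. by move=> sG; rewrite (fixed_gal _ sG) ?sub1v ?rpredZ ?mem1v. Qed.

Lemma gal_exp s (w : K) (c : F) :
  s \in 'Gal({:K} / 1)%g -> w ^+ p = c%:A -> s w ^+ p = c%:A.
Proof. by move=> sG wc; rewrite -rmorphXn wc; exact: gal_alg. Qed.

Lemma galNorm_alg (c : F) : galNorm 1 {:K} c%:A = (c ^+ p)%:A.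
Proof.
rewrite /galNorm (eq_bigr (fun=> c%:A)) => [|s sG]; last exact: gal_alg.
by rewrite prodr_const card_gal_cyclic_ext -!in_algE rmorphXn.
Qed.

Lemma norm_image_exp (c : F) : c != 0 -> c ^+ p \in norm_image K.
Proof.
move=> c0; apply/norm_imageP; exists c%:A; last exact: galNorm_alg.
by rewrite -in_algE fmorph_eq0.
Qed.

Lemma fixed_cyclic_ext s w : s \in 'Gal({:K} / 1)%g -> s != 1%g -> s w = w ->
  exists c : F, w = c%:A.
Proof.
move=> sG s1 sw; have [galK _ _] := cK; apply/vlineP.
rewrite -(galois_fixedField galK); apply/fixedFieldP; first exact: memvf.
have gen_s : <[s]>%g = 'Gal({:K} / 1)%g.
  apply/eqP; rewrite eqEcard cycle_subG sG /= -orderE card_gal_cyclic_ext.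
  rewrite dvdn_leq ?order_gt0 //; have := order_dvdG sG.
  rewrite card_gal_cyclic_ext => /(primeP p_pr).2 /orP[|/eqP->//].
  by rewrite order_eq1 (negPf s1).
move=> t; rewrite -gen_s => /cycleP[n ->].
elim: n => [|n IH]; first by rewrite expg0 gal_id.
by rewrite expgS galM ?memvf // sw.
Qed.

Lemma nontrivial_gal : exists2 s, s \in 'Gal({:K} / 1)%g & s != 1%g.
Proof. by apply/trivgPn; rewrite trivg_card1 card_gal_cyclic_ext; case: p p_pr => [|[]]. Qed.

Let xiKP : p.-primitive_root (xi%:A : K).
Proof. by rewrite -in_algE fmorph_primitive_root. Qed.

Lemma root_of_exp (y : F) (w : K) : w ^+ p = (y ^+ p)%:A -> exists c : F, w = c%:A.
Proof.
rewrite -in_algE rmorphXn => /(eq_exp_prim_root xiKP)[k ->].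
by exists (xi ^+ k * y); rewrite -!in_algE rmorphM rmorphXn.
Qed.

Hypothesis zp : z ^+ p = a%:A.
Hypothesis z_notin : z \notin 1%VS.

Let z0 : z != 0. Proof. by apply: contraNneq z_notin => ->; exact: mem0v. Qed.

Lemma gal_Kummer s : s \in 'Gal({:K} / 1)%g ->
  exists k : nat, s z = (xi ^+ k)%:A * z.
Proof.
move=> sG; have /(eq_exp_prim_root xiKP)[k ->] : s z ^+ p = z ^+ p.
  by rewrite (gal_exp sG zp) zp.
by exists k; rewrite -!in_algE rmorphXn.
Qed.

Lemma gal_Kummer_inj :
  {in 'Gal({:K} / 1)%g &, injective (fun s : gal_of {:K} => s z)}.
Proof.
move=> s t sG tG st; apply/eqP/contraT => st_neq.
have [|||c zc] := @fixed_cyclic_ext (s * t^-1)%g z.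
- by rewrite groupM ?groupV.
- by rewrite -eq_mulgV1.
- by rewrite galM ?memvf // st -galM ?memvf // mulgV gal_id.
by case/negP: z_notin; apply/vlineP; exists c.
Qed.

Lemma galNorm_sub (c : F) : galNorm 1 {:K} (c%:A - z) = (c ^+ p - a)%:A.
Proof.
have aE : 'X^p - (a%:A)%:P = \prod_(s in 'Gal({:K} / 1)%g) ('X - (s z)%:P).
  rewrite -big_filter -/(enum _) -(big_map _ xpredT (fun r => 'X - r%:P)).
  rewrite [LHS](@all_roots_prod_XsubC _ _
    [seq s z | s : gal_of {:K} <- enum 'Gal({:K} / 1)%g]).
  - by rewrite (monicP (monicXnsubC _ p_gt0)) scale1r.
  - by rewrite size_XnsubC // size_map -cardE card_gal_cyclic_ext.
  - apply/allP => r /mapP[s]; rewrite mem_enum => sG ->.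
    by rewrite rootE !hornerE (gal_exp sG zp) subrr.
  - rewrite uniq_rootsE map_inj_in_uniq ?enum_uniq // => s t.
    by rewrite !mem_enum; exact: gal_Kummer_inj.
transitivity (('X^p - (a%:A)%:P).[c%:A] : K); last first.
  by rewrite !hornerE -!in_algE rmorphB rmorphXn.
rewrite aE horner_prod; apply: eq_bigr => s sG.
by rewrite rmorphB !hornerE; congr (_ - _); exact: gal_alg.
Qed.

Lemma galNorm_Kummer_term (c : F) i :
  galNorm 1 {:K} (c%:A * z ^+ i) = ((- a) ^+ i * (c * (-1) ^+ i) ^+ p)%:A.
Proof.
have zE : z = (-1)%:A * (0%:A - z) by rewrite scale0r sub0r scaleN1r mulrNN mul1r.
rewrite {1}zE galNormM galNormX galNormM !galNorm_alg galNorm_sub -!in_algE.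
rewrite -rmorphM -rmorphXn -rmorphM expr0n gtn_eqF // sub0r; congr (in_alg K _).
by rewrite !exprMn exprAC; ring.
Qed.

Lemma pth_root_Kummer (w : K) (c : F) : w ^+ p = c%:A ->
  exists (k : nat) (b : F), w = b%:A * z ^+ k.
Proof.
move=> wc; have [->|w0] := eqVneq w 0.
  by exists 0%N, 0; rewrite scale0r mul0r.
have [s sG s1] := nontrivial_gal.
have root1 (y : K) d : y != 0 -> y ^+ p = d%:A -> (s y / y) ^+ p = 1.
  by move=> y0 yd; rewrite expr_div_n (gal_exp sG yd) -yd divff // expf_neq0.
have zetaP : p.-primitive_root (s z / z).
  have zeta_p := root1 _ _ z0 zp.
  have [m mP m_dvd] := prim_order_exists p_gt0 zeta_p.
  have /orP[/eqP m1|/eqP <-//] := (primeP p_pr).2 _ m_dvd.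
  have := prim_expr_order mP; rewrite m1 expr1 => /(canRL (divfK z0)).
  rewrite mul1r => /(fixed_cyclic_ext sG s1) z_alg.
  by case/negP: z_notin; exact/vlineP.
have /(prim_rootP zetaP)[k ek] := root1 _ _ w0 wc.
have [b wb] : exists b : F, w / z ^+ k = b%:A.
  apply: (fixed_cyclic_ext sG s1).
  have swE : s w = (s z / z) ^+ k * w by rewrite -ek divfK.
  rewrite fmorph_div rmorphXn /= swE -{2}(divfK z0 (s z)).
  move: (s z / z) zetaP => zeta zetaP; rewrite exprMn -mulf_div divff ?mul1r //.
  by rewrite expf_neq0 // (prim_root_eq0 zetaP) -lt0n.
by exists k, b; rewrite -wb divfK // expf_neq0.
Qed.

End KummerNorm.

Section KummerSubfields.
Variables (W : fieldType) (p : nat) (xi : W).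
Hypotheses (p_pr : prime p) (xiP : p.-primitive_root xi).
Implicit Types (F G H : divringClosed W) (y w : W).

Lemma adjoin_exp_Kummer F y w :
    xi \in F -> y ^+ p \in F -> y \notin F -> w \in adjoin F y -> w ^+ p \in F ->
  exists (m : nat) (f : W), f \in F /\ w = f * y ^+ m.
Proof.
move=> Fxi Fyp Fy /adjoinP[f [g [Ff Fg g0 wE]]] Fwp.
pose iota := inclusion F.
have xiFP : p.-primitive_root (Subfield Fxi) by rewrite -(fmorph_primitive_root iota).
have a_npow : Subfield Fyp \notin powers p predT.
  apply: contra Fy => /powersP[c _ /(congr1 iota)]; rewrite rmorphXn /=.
  move=> /(eq_exp_prim_root xiP)[k ->].
  by rewrite rpredM ?rpredX ?subfield_valP.
have [K [z [j [cK zp jz jA _]]]] :=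
  Kummer_extension p_pr xiFP a_npow (erefl : y ^+ p = iota (Subfield Fyp)).
have z_notin := pth_root_notin a_npow zp.
have [f' fE] := polyOver_subfield Ff; have [g' gE] := polyOver_subfield Fg.
have j_horner (q : {poly subfield_type F}) :
    j (map_poly (in_alg K) q).[z] = (map_poly iota q).[y].
  rewrite -horner_map jz -map_poly_comp; congr (_.[_]).
  by apply: eq_map_poly => c /=; rewrite jA.
pose w' := (map_poly (in_alg K) f').[z] / (map_poly (in_alg K) g').[z].
have jw : j w' = w by rewrite fmorph_div !j_horner wE fE gE.
have [|k [b wb]] := @pth_root_Kummer _ _ _ _ _ p_pr cK zp z_notin w' (Subfield Fwp).
  by apply: (fmorph_inj j); rewrite rmorphXn /= jA jw.
exists k, (iota b); split; first exact: subfield_valP.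
by rewrite -jw wb rmorphM rmorphXn /= jA jz.
Qed.

Lemma indep_mod_adjoin (E : choiceType) (T : E -> W) F y :
    xi \in F -> (forall i, T i \in F) -> (forall i, T i != 0) ->
    y ^+ p \in F -> y \notin F -> indep_mod p (powers p F) T ->
    ~ span_mod (powers p F) T (y ^+ p) ->
  indep_mod p (powers p (adjoin F y)) T.
Proof.
move=> Fxi FT T0 Fyp Fy T_indep y_nspan n /powersP[w Gw nw].
have Fwp : w ^+ p \in F by rewrite -nw; apply: rpred_monomial.
have [m [f [Ff wE]]] := adjoin_exp_Kummer Fxi Fyp Fy Gw Fwp.
have [pm|pm] := boolP (p %| m)%N.
  apply: T_indep; rewrite nw wE; apply: mem_powers.
  by rewrite rpredM // -(divnK pm) mulnC exprM rpredX.
have w0 : w != 0.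
  have : w ^+ p != 0 by rewrite -nw monomial_neq0.
  by rewrite expf_eq0 prime_gt0.
have [|u [v uv]] := coprime_expz W (m := m) (n := p); first exact: prime_coprime_mod.
have y0 : y != 0 by apply: contraNneq Fy => ->; rewrite rpred0.
have f0 : f != 0 by apply: contraNneq w0 => f0; rewrite wE f0 mul0r.
case: y_nspan; exists (n *~ u); apply/powersP; exists ((y ^+ p) ^ v / f ^ u).
  by rewrite rpred_div ?rpredXz.
have yE : y = w ^ u * ((y ^+ p) ^ v / f ^ u).
  rewrite -[LHS](uv y y0) wE expfzMl.
  by move: (f ^ u) (expfz_neq0 u f0) => fu fu0; field.
rewrite monomialMz // nw [in LHS]yE exprMn.
have -> : (w ^ u) ^+ p = (w ^+ p) ^ u by rewrite !exprnP !exprz_exp mulrC.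
by rewrite mulrAC divff ?mul1r // expfz_neq0 // expf_neq0.
Qed.

Lemma Kummer_maximal_subfield (E : choiceType) (T : E -> W) F0 H :
    xi \in F0 -> (forall i, T i \in F0) -> (forall i, T i != 0) ->
    {subset F0 <= H} -> indep_mod p (powers p F0) T ->
  exists F, [/\ {subset F0 <= F}, {subset F <= H}, indep_mod p (powers p F) T &
    forall c, c \in F -> c \in powers p H -> span_mod (powers p F) T c].
Proof.
move=> F0xi F0T T0 F0H T_indep.
pose R F y := y \in H /\ forall n : {malg int[E]},
  monomial T n = y ^+ p -> forall i, (p %| n@_i)%Z.
have [//||F [F0F RF maxF]] := @subfield_Zorn W R F0.
  by move=> y F0y; split=> [|n ny]; [exact: F0H | apply: T_indep; rewrite ny mem_powers].
have indepF : indep_mod p (powers p F) T.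
  by move=> n /powersP[y /RF[_]]; apply.
have FH y : y \in F -> y \in H by case/RF.
exists F; split=> // c Fyp /powersP[y Hy cy]; rewrite {}cy in Fyp *.
have [Fy|Fy] := boolP (y \in F).
  by exists 0; rewrite monomial0 divr1 mem_powers.
apply: contrapT => nspan; case/negP: Fy.
apply: (maxF (adjoin F y)); [exact: sub_adjoin | move=> w Gw | exact: mem_adjoin].
split=> [|n nw]; first exact: (adjoin_min FH Hy).
have Fy : y \notin F.
  by apply/negP => Fy; apply: nspan; exists 0; rewrite monomial0 divr1 mem_powers.
apply: (indep_mod_adjoin _ _ T0 Fyp Fy indepF nspan); rewrite ?nw ?mem_powers //.
  exact: F0F.
by move=> i; exact: F0F.
Qed.

End KummerSubfields.

(** * Valuations and leading terms *)

(* [m] is the maximal ideal of a valuation ring of [W], namely of the ring of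
   the x such that x = 0 or x^-1 is not in m. *)
Record val_ideal (W : fieldType) (m : W -> Prop) : Prop := ValIdeal {
  val0 : m 0;
  val1 : ~ m 1;
  valD : forall x y, m x -> m y -> m (x + y);
  valM : forall x y, m x -> ~ m y^-1 -> m (x * y);
  valV : forall x, m x -> x != 0 -> ~ m x^-1 }.

Section Valuation.
Variables (W : fieldType) (m : W -> Prop).
Hypothesis mP : val_ideal m.
Implicit Types x y z : W.

Definition vlt x y := y != 0 /\ m (x / y).
Definition vsim x y := vlt (x - y) y.

Lemma valN1 : ~ m (- 1).
Proof.
move=> mN1; apply: (valV mP mN1); first by rewrite oppr_eq0 oner_eq0.
by rewrite invrN invr1.
Qed.

Lemma valN x : m x -> m (- x).
Proof. by rewrite -mulrN1 => mx; apply: (valM mP) => //; rewrite invrN1; exact: valN1. Qed.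

Lemma valMm x y : m x -> m y -> m (x * y).
Proof.
move=> mx my; have [->|y0] := eqVneq y 0; first by rewrite mulr0; exact: val0 mP.
by apply: (valM mP) => //; apply: (valV mP).
Qed.

Lemma val_prime x y : m (x * y) -> m x \/ m y.
Proof.
move=> mxy; have [my|my] := pselect (m y); [by right|left].
have y0 : y != 0 by apply: contra_notN my => /eqP ->; exact: val0 mP.
by rewrite -(mulfK y0 x); apply: (valM mP); rewrite ?invrK.
Qed.

Lemma val_prime_exp x n : m (x ^+ n) -> m x.
Proof.
elim: n => [|n IH]; first by rewrite expr0 => /(val1 mP).
by rewrite exprS => /val_prime[].
Qed.

Lemma val_root_of_unity u n : (0 < n)%N -> u ^+ n = 1 -> ~ m u.
Proof.
move=> n_gt0 un mu; apply: (val1 mP); rewrite -un; case: n n_gt0 {un} => // n _.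
by elim: n => // n IH; rewrite exprS; exact: valMm.
Qed.

Lemma vlt_roots_of_unity u v x y n : (0 < n)%N -> u ^+ n = 1 -> v ^+ n = 1 ->
  vlt x y -> vlt (u * x) (v * y).
Proof.
move=> n_gt0 un vn [y0 xy].
have v0 : v != 0.
  by apply: contra_eq_neq vn => ->; rewrite expr0n gtn_eqF // eq_sym oner_neq0.
split; first by rewrite mulf_neq0.
rewrite -mulf_div mulrC; apply: (valM mP) => //; rewrite invf_div.
by apply: (val_root_of_unity n_gt0); rewrite expr_div_n un vn divr1.
Qed.

Lemma vlt_trans y x z : vlt x y -> vlt y z -> vlt x z.
Proof.
move=> [y0 xy] [z0 yz]; split => //.
have -> : x / z = (x / y) * (y / z) by rewrite mulrA divfK.
exact: valMm.
Qed.

Lemma vltxx x : ~ vlt x x.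
Proof. by move=> [x0]; rewrite mulfV //; exact: val1 mP. Qed.

Lemma vlt0 y : y != 0 -> vlt 0 y.
Proof. by split=> //; rewrite mul0r; exact: val0 mP. Qed.

Lemma vltx1 x : vlt x 1 <-> m x.
Proof. by rewrite /vlt divr1 oner_eq0; split=> [[]|]. Qed.

Lemma vltNl x y : vlt x y -> vlt (- x) y.
Proof. by move=> [y0 xy]; split=> //; rewrite mulNr; exact: valN. Qed.

Lemma vltNr x y : vlt x y -> vlt x (- y).
Proof. by move=> [y0 xy]; split; rewrite ?oppr_eq0 // invrN mulrN; exact: valN. Qed.

Lemma vltD x y z : vlt x z -> vlt y z -> vlt (x + y) z.
Proof. by move=> [z0 xz] [_ yz]; split=> //; rewrite mulrDl; exact: (valD mP). Qed.

Lemma vlt_le_trans y x z : vlt x y -> ~ vlt z y -> vlt x z.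
Proof.
move=> [y0 xy] nzy; have [z0|z0] := eqVneq z 0.
  by case: nzy; rewrite z0; exact: vlt0.
split=> //; have -> : x / z = (x / y) * (y / z) by rewrite mulrA divfK.
by apply: (valM mP) => //; rewrite invf_div => zy; apply: nzy.
Qed.

Lemma vle_lt_trans y x z : ~ vlt y x -> vlt y z -> vlt x z.
Proof.
move=> nyx [z0 yz]; have [->|x0] := eqVneq x 0; first exact: vlt0.
have y0 : y != 0 by apply: contra_notN nyx => /eqP ->; exact: vlt0.
split=> //; have -> : x / z = (y / z) * (x / y) by rewrite [RHS]mulrC mulrA divfK.
by apply: (valM mP) => //; rewrite invf_div => yx; apply: nyx.
Qed.

Lemma vltMl u x y : u != 0 -> vlt x y -> vlt (u * x) (u * y).
Proof.
move=> u0 [y0 xy]; split; first by rewrite mulf_neq0.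
by rewrite -mulf_div mulfV // mul1r.
Qed.

Lemma vltM x y x' y' : vlt x y -> vlt x' y' -> vlt (x * x') (y * y').
Proof.
by move=> [y0 xy] [y'0 xy']; split; rewrite ?mulf_neq0 // -mulf_div; exact: valMm.
Qed.

Lemma vlt_exp x y n : vlt (x ^+ n) (y ^+ n) -> vlt x y.
Proof.
case: n => [/vltxx//|n [yn]]; rewrite -expr_div_n => /val_prime_exp xy.
by split=> //; move: yn; rewrite expf_eq0.
Qed.

Lemma vlt_total_div x y : x != 0 -> y != 0 -> m (x / y) \/ m (x / y)^-1 ->
  vlt x y \/ vlt y x.
Proof. by move=> x0 y0 [xy|yx]; [left|right]; split; rewrite // -invf_div. Qed.

Lemma vsim_neq0l x y : vsim x y -> x != 0.
Proof.
move=> [y0]; apply: contraPneq => ->; rewrite sub0r mulNr mulfV //.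
exact: valN1.
Qed.

Lemma vsim_neq0r x y : vsim x y -> y != 0. Proof. by case. Qed.

Lemma vsim_refl x : x != 0 -> vsim x x.
Proof. by move=> x0; rewrite /vsim subrr; exact: vlt0. Qed.

Lemma vsim_addr x y : vlt x y -> vsim (y + x) y.
Proof. by rewrite /vsim addrAC subrr add0r. Qed.

Lemma vlt_simr x y z : vlt x y -> vsim y z -> vlt x z.
Proof.
move=> xy [z0 yz]; apply: (vlt_le_trans xy) => -[y0 zy].
have e : z / y * ((y - z) / z + 1) = 1 by field; rewrite y0 z0.
apply: (val1 mP); rewrite -e mulrDr mulr1; apply: (valD mP) => //.
exact: valMm.
Qed.

Lemma vsim_sym x y : vsim x y -> vsim y x.
Proof.
move=> xy; have x0 := vsim_neq0l xy; have y0 := vsim_neq0r xy.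
apply: contrapT => nyx; apply: (@vltxx y).
have nx : ~ vlt (x - y) x by rewrite -opprB => /vltNl; rewrite opprK => /nyx.
have lxy : vlt x y by exact: vle_lt_trans nx xy.
by have := vltD (vltNl xy) lxy; rewrite opprB subrK.
Qed.

Lemma vsim_trans y x z : vsim x y -> vsim y z -> vsim x z.
Proof.
move=> xy yz; rewrite /vsim -(subrK y x) -addrA.
by apply: vltD => //; apply: vlt_simr yz.
Qed.

Lemma vlt_siml y x z : vsim x y -> vlt y z -> vlt x z.
Proof.
move=> xy yz; rewrite -(subrK y x); apply: vltD => //.
exact: vlt_trans yz.
Qed.

Lemma vsimM x y x' y' : vsim x y -> vsim x' y' -> vsim (x * x') (y * y').
Proof.
move=> xy xy'; apply: (@vsim_trans (y * x')).
  rewrite /vsim -mulrBl ![_ * x']mulrC; apply: vltMl xy; exact: vsim_neq0l xy'.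
rewrite /vsim -mulrBr; apply: vltMl xy'; exact: vsim_neq0r xy.
Qed.

Lemma vsimV x y : vsim x y -> vsim x^-1 y^-1.
Proof.
move=> /vsim_sym yx; have x0 := vsim_neq0r yx; have y0 := vsim_neq0l yx.
case: yx => _ yx; split; first by rewrite invr_eq0.
have -> // : (x^-1 - y^-1) / y^-1 = (y - x) / x.
by rewrite !mulrBl !mulfV ?invr_eq0 // invrK [in LHS]mulrC.
Qed.

Lemma vsim_prod (I : Type) (s : seq I) (P : pred I) (f g : I -> W) :
  (forall i, P i -> vsim (f i) (g i)) ->
  vsim (\prod_(i <- s | P i) f i) (\prod_(i <- s | P i) g i).
Proof.
move=> fg; apply: (big_ind2 vsim) => //; first by apply: vsim_refl; exact: oner_neq0.
by move=> *; exact: vsimM.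
Qed.

Lemma vsimX x y n : vsim x y -> vsim (x ^+ n) (y ^+ n).
Proof.
move=> xy; rewrite -(card_ord n) -!prodr_const.
by apply: vsim_prod.
Qed.

Lemma vsim1E x : vsim x 1 <-> m (x - 1).
Proof. exact: vltx1. Qed.

Lemma vsim1_unit x : vsim x 1 -> ~ m x /\ ~ m x^-1.
Proof.
have not_m y : vsim y 1 -> ~ m y.
  by move=> y1 /vltx1 /(vlt_siml (vsim_sym y1)); exact: vltxx.
by move=> x1; split; apply: not_m => //; rewrite -[1]invr1; exact: vsimV.
Qed.

Lemma vsim_div x y : vsim x y -> vsim (x / y) 1.
Proof.
move=> xy; have y0 := vsim_neq0r xy; rewrite -(mulfV y0).
by apply: vsimM xy _; apply: vsim_refl; rewrite invr_eq0.
Qed.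

Lemma dominant_term (I : finType) (f : I -> W) :
    (exists i, f i != 0) ->
    (forall i l, i != l -> f i != 0 -> f l != 0 -> vlt (f i) (f l) \/ vlt (f l) (f i)) ->
  exists i, f i != 0 /\ forall l, l != i -> vlt (f l) (f i).
Proof.
move=> [i0 fi0] f_total; pose vge x y := `[< ~ vlt x y >].
have vge_refl : reflexive vge by move=> x; apply/asboolP; exact: vltxx.
have vge_trans : transitive vge.
  move=> y x z /asboolP nxy /asboolP nyz; apply/asboolP => xz; apply: nyz.
  exact: vle_lt_trans nxy xz.
have vge_total : total vge.
  move=> x y; apply/orP; have [xy|nxy] := pselect (vlt x y); [right|by left; apply/asboolP].
  by apply/asboolP => yx; apply: (@vltxx x); exact: vlt_trans yx.
have [i _ i_max] := @extremumP _ _ vge i0 xpredT f vge_refl vge_trans vge_total isT.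
have fi : f i != 0.
  apply/eqP => fi; have /asboolP := i_max i0 isT; rewrite fi; apply; exact: vlt0.
exists i; split=> // l li; have [->|fl] := eqVneq (f l) 0; first exact: vlt0.
have [//|il] := f_total l i li fl fi.
by have /asboolP := i_max l isT.
Qed.

Lemma vsim_sum (I : finType) (f : I -> W) i :
  f i != 0 -> (forall l, l != i -> vlt (f l) (f i)) -> vsim (\sum_l f l) (f i).
Proof.
move=> fi f_lt; rewrite (bigD1 i) //=; apply: vsim_addr.
apply: (big_ind (fun u => vlt u (f i))) => //; first exact: vlt0.
by move=> *; exact: vltD.
Qed.

End Valuation.

Section Dominated.
Variables (W : fieldType) (m : W -> Prop).
Hypothesis mP : val_ideal m.
Implicit Types (G : divClosed W) (H k : divringClosed W).

Definition dominated (G : {pred W}) H :=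
  forall h, h \in H -> h != 0 -> exists2 g, g \in G & vsim m h g.

(* When [G] represents the leading terms of a subfield of [H], maximality of [H]
   among the immediate extensions of that subfield. *)
Definition maximal_dominated (G : {pred W}) H := dominated G H /\
  forall H', {subset H <= H'} -> dominated G H' -> {subset H' <= H}.

Lemma maximal_dominated_exists (G : {pred W}) k : dominated G k ->
  exists H, {subset k <= H} /\ maximal_dominated G H.
Proof.
pose R (_ : divringClosed W) h := h != 0 -> exists2 g, g \in G & vsim m h g.
move=> domk; have [//|//|H [kH domH maxH]] := @subfield_Zorn W R k.
by exists H; split.
Qed.

Section Adjunction.
Variables (G : divClosed W) (k : divringClosed W) (x : W).
Hypotheses (x_neq0 : x != 0) (domk : dominated G k).
Hypothesis x_indep : forall g i, g \in G -> (0 < i)%N -> m (g * x ^+ i) \/ m (g * x ^+ i)^-1.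

Lemma dominated_horner (f : {poly W}) : f \is a polyOver k -> f != 0 ->
  exists i g, g \in G /\ vsim m f.[x] (g * x ^+ i).
Proof.
move=> /polyOverP kf f0; pose t (i : 'I_(size f)) := f`_i * x ^+ i.
have t_lead (i : 'I_(size f)) : t i != 0 -> exists2 g, g \in G & vsim m (t i) (g * x ^+ i).
  rewrite mulf_eq0 negb_or => /andP[fi xi]; have [g Gg fg] := domk (kf i) fi.
  by exists g => //; apply: vsimM => //; exact: vsim_refl.
have [||i [ti t_lt]] := @dominant_term _ _ mP _ t.
- have sz : (0 < size f)%N by rewrite size_poly_gt0.
  have lt_sz : ((size f).-1 < size f)%N by rewrite prednK.
  exists (Ordinal lt_sz); rewrite mulf_neq0 ?expf_neq0 //.
  by rewrite -/(lead_coef f) lead_coef_eq0.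
- move=> i l il ti tl; wlog: i l il ti tl / (i < l)%N => [th|{il}il].
    by have := il; rewrite -val_eqE neq_ltn => /orP[/th|/th/or_comm]; apply; rewrite // eq_sym.
  have [gi Gi ti_gi] := t_lead i ti; have [gl Gl tl_gl] := t_lead l tl.
  have gi0 := vsim_neq0r ti_gi; have gl0 := vsim_neq0r tl_gl.
  have [|lt|lt] := @vlt_total_div _ m (gl * x ^+ l) (gi * x ^+ i) gl0 gi0.
  + rewrite -mulf_div -(subnK (ltnW il)) exprD mulfK ?expf_neq0 //.
    by apply: x_indep; rewrite ?rpred_div // subn_gt0.
  + by right; apply: (vlt_siml mP tl_gl); apply: (vlt_simr mP lt); exact: vsim_sym.
  + by left; apply: (vlt_siml mP ti_gi); apply: (vlt_simr mP lt); exact: vsim_sym.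
have [g Gg tg] := t_lead i ti; exists i, g; split=> //.
by rewrite horner_coef; apply: vsim_trans tg => //; exact: vsim_sum.
Qed.

Lemma dominated_transcendental (f : {poly W}) :
  f \is a polyOver k -> f != 0 -> f.[x] != 0.
Proof.
by move=> kf f0; have [i [g [_ fg]]] := dominated_horner kf f0; exact: vsim_neq0l fg.
Qed.

Lemma dominated_adjoin (G' : divClosed W) :
  {subset G <= G'} -> x \in G' -> dominated G' (adjoin k x).
Proof.
move=> GG' G'x _ /adjoinP[f [f' [kf kf' f'x ->]]] ff'0.
have horner_neq0 (q : {poly W}) : q.[x] != 0 -> q != 0.
  by apply: contraNneq => ->; rewrite horner0.
have fx : f.[x] != 0 by apply: contraNneq ff'0 => ->; rewrite mul0r.
have [i [g [/GG' Gg fg]]] := dominated_horner kf (horner_neq0 _ fx).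
have [i' [g' [/GG' Gg' fg']]] := dominated_horner kf' (horner_neq0 _ f'x).
exists (g * x ^+ i / (g' * x ^+ i')); first by rewrite rpred_div ?rpredM ?rpredX.
by apply: vsimM => //; exact: vsimV.
Qed.

End Adjunction.
End Dominated.

(* Kaplansky's argument: if g were not in H, it could be approximated from H
   without a best approximation.  Among the elements rho with the same
   approximations as g choose one of least degree over H; then no root of a
   polynomial of smaller degree is approximated as well as g by H, so that the
   extension H(rho) of H is immediate. *)
Section PseudoLimit.
Variables (W : closedFieldType) (m : W -> Prop) (G : divClosed W) (H : divringClosed W).
Hypotheses (mP : val_ideal m) (maxH : maximal_dominated m G H).
Variable g : W.
Hypothesis g_approx :
  forall h, h \in H -> g != h -> exists2 h', h' \in H & vsim m (g - h) h'.

Let near r := forall h, h \in H -> vlt m (r - g) (g - h).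

Section Missing.
Hypothesis Hg : g \notin H.

Let g_neq h : h \in H -> g != h. Proof. by move=> Hh; apply: contraNneq Hg => ->. Qed.

Lemma better_approximation h :
  h \in H -> exists2 h', h' \in H & vlt m (g - h') (g - h).
Proof.
move=> Hh; have [h' Hh' gh'] := g_approx Hh (g_neq Hh).
exists (h + h'); first by rewrite rpredD.
by rewrite opprD addrA; apply: vlt_simr gh' (vsim_sym mP gh').
Qed.

Lemma separate_roots (rs : seq W) : (forall r, r \in rs -> ~ near r) ->
  exists2 h, h \in H & forall r, r \in rs -> vlt m (g - h) (g - r).
Proof.
elim: rs => [|r rs IH] far; first by exists 0; rewrite ?rpred0.
have [|h1 Hh1 h1_lt] := IH; first by move=> s rs_s; apply: far; rewrite in_cons rs_s orbT.
have /existsNP[h0 /not_implyP[Hh0 r_far]] := far r (mem_head _ _).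
have [h2 Hh2 h2_lt] := better_approximation Hh0.
have h2_r : vlt m (g - h2) (g - r).
  by rewrite -[g - r]opprB; apply: vltNr => //; apply: vlt_le_trans h2_lt r_far.
have [h12|h12] := pselect (vlt m (g - h1) (g - h2)).
  by exists h1 => // s; rewrite in_cons => /predU1P[->|/h1_lt//]; exact: vlt_trans h2_r.
exists h2 => // s; rewrite in_cons => /predU1P[->//|/h1_lt].
exact: vle_lt_trans h12.
Qed.

Lemma horner_near (f : {poly W}) rho : f \is a polyOver H -> f != 0 -> near rho ->
  (forall r, root f r -> ~ near r) -> exists2 h, h \in H & vsim m f.[rho] h.
Proof.
move=> Hf f0 rho_near f_far; have [rs fE] := closed_field_poly_normal f.
have lf0 : lead_coef f != 0 by rewrite lead_coef_eq0.
have [r rs_r|h Hh h_lt] := @separate_roots rs.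
  by apply: f_far; rewrite fE rootZ // root_prod_XsubC.
exists f.[h]; first by rewrite rpred_horner.
rewrite fE !hornerZ !horner_prod; apply: vsimM => //; first exact: vsim_refl.
rewrite !big_seq; apply: vsim_prod => // r /h_lt gr; rewrite !hornerE.
apply: (@vsim_trans _ _ mP (g - r)).
  have -> : rho - r = (g - r) + (rho - g) by ring.
  by apply: vsim_addr; apply: vlt_trans gr => //; apply: rho_near.
apply: vsim_sym => //; have -> : h - r = (g - r) - (g - h) by ring.
by apply: vsim_addr; apply: vltNl.
Qed.

Lemma near_notin r : near r -> r \notin H.
Proof.
move=> r_near; apply/negP => Hr; apply: (@vltxx _ _ mP (r - g)).
by rewrite -{2}[r - g]opprK opprB; apply: vltNr => //; apply: r_near.
Qed.

Lemma near_minimal_adjoin (q : {poly W}) rho :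
    q \is a polyOver H -> root q rho -> near rho ->
    (forall f r, f \is a polyOver H -> f != 0 -> root f r -> near r ->
       (size q <= size f)%N) ->
    q != 0 -> dominated m G (adjoin H rho).
Proof.
move=> Hq /eqP q_rho rho_near q_min q0; have [domH _] := maxH.
have lead f : f \is a polyOver H -> f.[rho] != 0 -> exists2 h, h \in G & vsim m f.[rho] h.
  move=> Hf f_rho; have fE : f.[rho] = (f %% q).[rho].
    by rewrite {1}(divp_eq f q) hornerD hornerM q_rho mulr0 add0r.
  rewrite fE in f_rho *; have Hfq := polyOver_modp Hf Hq.
  have fq0 : f %% q != 0 by apply: contraNneq f_rho => ->; rewrite horner0.
  have [|h Hh fh] := horner_near Hfq fq0 rho_near.
    move=> r fr r_near; have := q_min _ _ Hfq fq0 fr r_near.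
    by rewrite leqNgt ltn_modpN0.
  have [u Gu hu] := domH h Hh (vsim_neq0r fh).
  by exists u => //; exact: vsim_trans hu.
move=> _ /adjoinP[f1 [f2 [Hf1 Hf2 f2_rho ->]]] x0.
have f1_rho : f1.[rho] != 0 by apply: contraNneq x0 => ->; rewrite mul0r.
have [u1 Gu1 fu1] := lead _ Hf1 f1_rho; have [u2 Gu2 fu2] := lead _ Hf2 f2_rho.
exists (u1 / u2); first exact: rpred_div.
by apply: vsimM => //; exact: vsimV.
Qed.

End Missing.

Lemma pseudo_limit_mem (f : {poly W}) :
  f \is a polyOver H -> f != 0 -> root f g -> g \in H.
Proof.
move=> Hf f0 fg; apply: contraT => Hg; have [_ H_max] := maxH.
have g_near : near g.
  move=> h Hh; rewrite subrr; apply: vlt0 => //.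
  by rewrite subr_eq0; apply: contraNneq Hg => ->.
pose near_size n := `[< exists q r,
  [/\ q \is a polyOver H, q != 0, root q r, near r & size q = n] >].
have ex_near_size : exists n, near_size n by exists (size f); apply/asboolP; exists f, g.
have [n /asboolP[q [rho [Hq q0 q_rho rho_near <-]]] q_min] := ex_minnP ex_near_size.
have /negP[] := near_notin rho_near; apply: (H_max (adjoin H rho)); last exact: mem_adjoin.
  exact: sub_adjoin.
apply: near_minimal_adjoin q_rho rho_near _ q0 => // h r Hh h0 hr r_near.
by apply: q_min; apply/asboolP; exists h, r.
Qed.

End PseudoLimit.

(** * Power classes of a maximal dominated field *)

Lemma closed_field_root (W : closedFieldType) p (c : W) :
  (0 < p)%N -> exists g, g ^+ p = c.
Proof.
move=> p_gt0; have /closed_rootP[g] : size ('X^p - c%:P) != 1%N.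
  by rewrite size_XnsubC // eqSS -lt0n.
by rewrite rootE !hornerE subr_eq0 => /eqP; exists g.
Qed.

Section UnitRoots.
Variables (W : closedFieldType) (m : W -> Prop) (p : nat) (xi : W).
Hypotheses (mP : val_ideal m) (p_pr : prime p) (xiP : p.-primitive_root xi).

Let p_gt0 : (0 < p)%N := prime_gt0 p_pr.

Lemma unit_root_exists c : vsim m c 1 -> exists2 g, vsim m g 1 & g ^+ p = c.
Proof.
move=> c1; have [g gc] := closed_field_root c p_gt0.
have g0 : g != 0.
  by apply: contraTneq (vsim_neq0l mP c1) => g0; rewrite -gc g0 expr0n gtn_eqF ?eqxx.
have /(congr1 (horner^~ 1)) := binomial_factor xiP g0.
rewrite !hornerE expr1n horner_prod gc => c1E.
suff [i gi] : exists i, m (1 - xi ^+ i * g).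
  exists (xi ^+ i * g); first by apply/(vsim1E m); rewrite -opprB; exact: valN.
  by rewrite exprMn exprAC (prim_expr_order xiP) expr1n mul1r.
have : m (\prod_(0 <= i < p) ('X - (xi ^+ i * g)%:P).[1]).
  by rewrite -c1E -opprB; apply: valN => //; exact/(vsim1E m).
elim: (index_iota 0 p) => [|i s IH]; first by rewrite big_nil => /(val1 mP).
rewrite big_cons => /(val_prime mP)[|//]; rewrite !hornerE => gi.
by exists i.
Qed.

Variables (G : divClosed W) (H : divringClosed W).
Hypotheses (maxH : maximal_dominated m G H) (Hxi : xi \in H).
Hypothesis xi_sep : forall i, (0 < i < p)%N -> ~ m (1 - xi ^+ i).

(* g^p - h^p is the product of g - h and of the g - xi^i h for 0 < i < p, whose
   leading terms are those of the 1 - xi^i. *)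
Lemma unit_root_approx g h :
    vsim m g 1 -> g ^+ p \in H -> h \in H -> g != h ->
  exists2 h', h' \in H & vsim m (g - h) h'.
Proof.
move=> g1 Hgp Hh gh; have [h1|h1] := pselect (vsim m h 1); last first.
  exists (1 - h); first by rewrite rpredB ?rpred1.
  have -> : g - h = (1 - h) + (g - 1) by ring.
  apply: vsim_addr; apply: (vlt_le_trans mP g1).
  by rewrite -opprB => /(vltNl mP); rewrite opprK => /h1.
have h0 := vsim_neq0l mP h1; pose d := \prod_(1 <= i < p) (1 - xi ^+ i).
have /(congr1 (horner^~ g)) := binomial_factor xiP h0.
rewrite !hornerE horner_prod big_ltn // !hornerE ?expr0 ?mul1r.
set r := \prod_(_ <= _ < _) _ => ghE.
have rd : vsim m r d.
  rewrite /r /d !big_nat; apply: vsim_prod => // i ip; rewrite !hornerE.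
  have -> : g - xi ^+ i * h = (1 - xi ^+ i) + ((g - 1) - xi ^+ i * (h - 1)) by ring.
  apply: vsim_addr; apply: (@vlt_le_trans _ _ mP 1); last by move/vltx1; exact: xi_sep.
  apply: vltD g1 (vltNl mP _) => //; apply/vltx1; rewrite mulrC.
  apply: (valM mP); first exact/vsim1E.
  apply: (val_root_of_unity mP p_gt0).
  by rewrite exprVn exprAC (prim_expr_order xiP) expr1n invr1.
exists ((g ^+ p - h ^+ p) / d).
  apply: rpred_div; first by rewrite rpredB // rpredX.
  by apply: rpred_prod => i _; rewrite rpredB ?rpred1 ?rpredX.
have r0 := vsim_neq0l mP rd.
have -> : g - h = (g ^+ p - h ^+ p) / r by rewrite ghE mulfK.
apply: vsimM => //; last exact: vsimV.
by apply: vsim_refl; rewrite // ghE mulf_neq0 // subr_eq0.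
Qed.

Lemma unit_is_power c : c \in H -> vsim m c 1 -> c \in powers p H.
Proof.
move=> Hc c1; have [g g1 gc] := unit_root_exists c1; apply/powersP; exists g => //.
apply: (pseudo_limit_mem mP maxH _ (f := 'X^p - c%:P)).
- by move=> h Hh; apply: unit_root_approx; rewrite ?gc.
- by rewrite rpredB ?polyOverC // rpredX // polyOverX.
- by rewrite monic_neq0 ?monicXnsubC.
- by rewrite rootE !hornerE gc subrr.
Qed.

Hypotheses (GH : {subset G <= H}) (G0 : 0 \notin G).
Hypothesis G_lead : forall g, g \in G -> vsim m g 1 -> g = 1.

Lemma vsim_power h g : h \in H -> g \in H -> vsim m h (g ^+ p) -> h \in powers p H.
Proof.
move=> Hh Hg hg; have gp0 := vsim_neq0r hg.
rewrite -(divfK gp0 h) rpredM ?mem_powers //; apply: unit_is_power; last exact: vsim_div.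
by rewrite rpred_div ?rpredX.
Qed.

Lemma maximal_decomposition h : h \in H -> h != 0 ->
  exists2 g, g \in G & h / g \in powers p H.
Proof.
move=> Hh h0; have [g Gg hg] := maxH.1 h Hh h0; exists g => //.
by apply: unit_is_power; [rewrite rpred_div // GH | exact: vsim_div].
Qed.

Lemma powers_leading_group g : g \in G -> g \in powers p H -> g \in powers p G.
Proof.
move=> Gg /powersP[u Hu gu]; have g0 : g != 0 by apply: contraNneq G0 => <-.
have u0 : u != 0 by apply: contraNneq g0 => u0; rewrite gu u0 expr0n gtn_eqF.
have [g' Gg' ug'] := maxH.1 u Hu u0; apply/powersP; exists g' => //.
have g'p0 : g' ^+ p != 0 by rewrite expf_neq0 // (vsim_neq0r ug').
apply: (divIf g'p0); rewrite divff //; apply: G_lead; first by rewrite rpred_div ?rpredX.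
by apply: vsim_div => //; rewrite gu; exact: vsimX.
Qed.

Lemma maximal_basis (I : choiceType) (b : I -> W) :
  basis_mod p G (powers p G) b -> basis_mod p [predI H & predC1 0] (powers p H) b.
Proof.
move=> [bG b_indep b_span]; have G_neq0 g : g \in G -> g != 0.
  by move=> Gg; apply: contraNneq G0 => <-.
split=> [i|n bn|h]; first by rewrite !inE GH ?G_neq0.
  by apply: b_indep; apply: powers_leading_group => //; exact: rpred_monomial.
rewrite inE => /andP[Hh h0]; have [g Gg hg] := maximal_decomposition Hh h0.
have [n /powersP[u Gu gn]] := b_span g Gg; exists n.
have -> : h / monomial b n = h / g * (g / monomial b n) by rewrite mulrA divfK ?G_neq0.
by rewrite rpredM // gn mem_powers // GH.
Qed.

End UnitRoots.

(** * Norms from Kummer extensions inside a maximal dominated field *)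

Section RamifiedNorm.
Variables (W : closedFieldType) (m : W -> Prop) (p : nat).
Variables (F : fieldType) (iota : {rmorphism F -> W}) (xi a : F).
Hypotheses (mP : val_ideal m) (p_pr : prime p) (xiP : p.-primitive_root xi).
Variables (G : divClosed W) (H : divringClosed W).
Hypotheses (maxH : maximal_dominated m G H) (iotaH : forall c, iota c \in H).
Hypothesis xi_sep : forall i, (0 < i < p)%N -> ~ m (1 - iota xi ^+ i).
Hypothesis a_ramified : forall g i, g \in G -> (0 < i < p)%N ->
  m (g ^+ p * iota a ^+ i) \/ m (g ^+ p * iota a ^+ i)^-1.

Variables (K : splittingFieldType F) (z : K) (j : {rmorphism K -> W}).
Hypotheses (cK : cyclic_ext p K) (zp : z ^+ p = a%:A) (z_notin : z \notin 1%VS).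
Hypothesis j_alg : forall c : F, j c%:A = iota c.
Hypothesis K_poly : forall w : K,
  exists2 q : {poly F}, (size q <= p)%N & w = (map_poly (in_alg K) q).[z].

Let p_gt0 : (0 < p)%N := prime_gt0 p_pr.
Let z_neq0 : z != 0. Proof. by apply: contraNneq z_notin => ->; exact: mem0v. Qed.
Let xi_exp k : (iota xi ^+ k) ^+ p = 1.
Proof. by rewrite -!rmorphXn exprAC (prim_expr_order xiP) expr1n rmorph1. Qed.

Lemma Kummer_term_lead (c : F) i : c != 0 ->
  exists2 g, g \in G & vsim m (j (c%:A * z ^+ i) ^+ p) (g ^+ p * iota a ^+ i).
Proof.
rewrite -(fmorph_eq0 iota) => c0; have [g Gg cg] := maxH.1 _ (iotaH c) c0.
exists g => //; have -> : j (c%:A * z ^+ i) ^+ p = iota c ^+ p * iota a ^+ i.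
  rewrite rmorphM exprMn j_alg; congr (_ * _).
  by rewrite rmorphXn exprAC -(rmorphXn j) zp j_alg.
apply: vsimM => //; first exact: vsimX.
by apply: vsim_refl; rewrite // expf_neq0 // -j_alg -zp fmorph_eq0 expf_neq0.
Qed.

Lemma Kummer_terms_comparable (c d : F) i l :
    c != 0 -> d != 0 -> (i < l < p)%N ->
  vlt m (j (c%:A * z ^+ i)) (j (d%:A * z ^+ l)) \/
  vlt m (j (d%:A * z ^+ l)) (j (c%:A * z ^+ i)).
Proof.
move=> c0 d0 /andP[il lp].
have [g Gg cg] := Kummer_term_lead i c0; have [h Gh dh] := Kummer_term_lead l d0.
have g0 := vsim_neq0r cg; have h0 := vsim_neq0r dh.
have [|lt|lt] := @vlt_total_div _ m _ _ h0 g0.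
- have a0 : iota a != 0 by rewrite -j_alg -zp fmorph_eq0 expf_neq0.
  rewrite -mulf_div -expr_div_n -(subnK (ltnW il)) exprD mulfK ?expf_neq0 //.
  apply: a_ramified; first exact: rpred_div.
  by rewrite subn_gt0 il (leq_ltn_trans (leq_subr _ _) lp).
- right; apply: (vlt_exp mP (n := p)); apply: (vlt_siml mP dh).
  by apply: (vlt_simr mP lt); exact: vsim_sym.
- left; apply: (vlt_exp mP (n := p)); apply: (vlt_siml mP cg).
  by apply: (vlt_simr mP lt); exact: vsim_sym.
Qed.

Lemma gal_Kummer_term (s : gal_of {:K}) (c : F) i k :
  s \in 'Gal({:K} / 1)%g -> s z = (xi ^+ k)%:A * z ->
  j (s (c%:A * z ^+ i)) = iota xi ^+ (k * i) * j (c%:A * z ^+ i).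
Proof.
move=> sG sz; have -> : s (c%:A * z ^+ i) = (xi ^+ (k * i))%:A * (c%:A * z ^+ i).
  rewrite rmorphM rmorphXn /= (gal_alg _ sG) sz exprMn mulrCA -!in_algE -rmorphXn.
  by rewrite exprM.
by rewrite rmorphM j_alg rmorphXn.
Qed.

Lemma Kummer_norm_lead (w : K) : w != 0 ->
  exists (i : nat) (c : F), vsim m (j (galNorm 1 {:K} w)) (j (galNorm 1 {:K} (c%:A * z ^+ i))).
Proof.
move=> w0; have [q q_size wE] := K_poly w.
pose t (l : 'I_p) : K := (q`_l)%:A * z ^+ l.
have {}wE : w = \sum_l t l.
  rewrite wE (horner_coef_wide z (n := p)) ?size_map_poly //.
  by apply: eq_bigr => l _; rewrite coef_map.
have t_neq0 l : j (t l) != 0 -> q`_l != 0.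
  by apply: contraNneq; rewrite /t => ->; rewrite scale0r mul0r rmorph0.
have [||i [ti t_lt]] := @dominant_term _ _ mP _ (fun l => j (t l)).
- apply: contrapT => t_eq0; case/eqP: w0; rewrite wE big1 // => l _.
  by apply/eqP; rewrite -(fmorph_eq0 j); apply/negPn/negP => tl; apply: t_eq0; exists l.
- move=> i l; rewrite -val_eqE neq_ltn => il /t_neq0 qi /t_neq0 ql.
  case/orP: il => il; [|apply/or_comm];
    by apply: Kummer_terms_comparable; rewrite ?il ?ltn_ord.
exists i, q`_i; rewrite /galNorm !rmorph_prod; apply: vsim_prod => // s sG.
have [k sz] := gal_Kummer xiP zp sG.
rewrite wE !rmorph_sum; apply: (vsim_sum mP (f := fun l => j (s (t l)))) => [|l li].
  by rewrite !fmorph_eq0 -(fmorph_eq0 j).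
rewrite !(gal_Kummer_term _ _ sG sz).
by apply: (vlt_roots_of_unity mP p_gt0); [exact: xi_exp | exact: xi_exp | exact: t_lt].
Qed.

Lemma ramified_norm c : c \in norm_image K ->
  exists i : nat, iota (c / (- a) ^+ i) \in powers p H.
Proof.
have iota_xiP : p.-primitive_root (iota xi) by rewrite fmorph_primitive_root.
move=> /norm_imageP[w /Kummer_norm_lead[i [d]]].
rewrite (galNorm_Kummer_term p_pr cK zp z_notin) => /[swap] ->; rewrite !j_alg.
set e := d * _ => ce; have ai0 : (- a) ^+ i != 0.
  by rewrite expf_neq0 // oppr_eq0 -(fmorph_eq0 iota) -j_alg -zp fmorph_eq0 expf_neq0.
exists i; apply: (vsim_power mP p_pr iota_xiP maxH (iotaH xi) xi_sep (iotaH _) (iotaH e)).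
rewrite -rmorphXn -(mulKf ai0 (e ^+ p)) (mulrC c) !(rmorphM iota ((- a) ^- i)).
by apply: (vsimM mP) => //; apply: (vsim_refl mP); rewrite fmorph_eq0 invr_eq0.
Qed.

End RamifiedNorm.

(** * Bases of the norm class groups *)

Section RamifiedBases.
Variables (W : closedFieldType) (m : W -> Prop) (p : nat).
Variables (F : fieldType) (iota : {rmorphism F -> W}) (xi : F).
Hypotheses (mP : val_ideal m) (p_pr : prime p) (xiP : p.-primitive_root xi).
Variables (G : divClosed W) (H : divringClosed W).
Hypotheses (maxH : maximal_dominated m G H) (iotaH : forall c, iota c \in H).
Hypotheses (GH : {subset G <= H}) (G0 : 0 \notin G).
Hypothesis G_lead : forall g, g \in G -> vsim m g 1 -> g = 1.
Hypothesis xi_sep : forall i, (0 < i < p)%N -> ~ m (1 - iota xi ^+ i).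

Variables (D E : choiceType) (b : unit + D -> F) (t c : E -> F) (e0 : E).
Hypothesis b_basis : basis_mod p G (powers p G) (iota \o b).
Hypotheses (tE : forall i, t i = c i ^+ p + b (inl tt)) (c_e0 : c e0 = 0).
Hypothesis t_indep : indep_mod p (powers p predT) t.
Hypothesis t_span : forall y, iota y \in powers p H -> span_mod (powers p predT) t y.

Let p_gt0 : (0 < p)%N := prime_gt0 p_pr.

Let a := - b (inl tt).
Hypothesis a_ramified : forall g i, g \in G -> (0 < i < p)%N ->
  m (g ^+ p * iota a ^+ i) \/ m (g ^+ p * iota a ^+ i)^-1.

Let b_neq0 i : b i != 0.
Proof.
rewrite -(fmorph_eq0 iota); apply: contraNneq G0 => <-.
by case: b_basis => bG _ _; exact: bG.
Qed.

Let t_e0 : t e0 = b (inl tt). Proof. by rewrite tE c_e0 expr0n gtn_eqF // add0r. Qed.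

Let t_neq0 i : t i != 0.
Proof.
have := indep_mod_notin i (prime_gt1 p_pr) t_indep; apply: contraNneq => ->.
by apply/powersP; exists 0; rewrite ?expr0n ?gtn_eqF.
Qed.

Lemma ramified_not_power : a \notin powers p predT.
Proof.
apply/negP => /powersP[y _ ay].
have y0 : iota y != 0.
  rewrite fmorph_eq0; apply: contra_eq_neq ay => ->.
  by rewrite expr0n gtn_eqF // oppr_eq0.
have [g Gg yg] := maxH.1 _ (iotaH y) y0.
have ag1 : vsim m (g^-1 ^+ p * iota a ^+ 1) 1.
  rewrite expr1 ay rmorphXn -exprMn -(expr1n _ p); apply: vsimX => //.
  by rewrite mulrC; exact: vsim_div.
have [nm nmV] := vsim1_unit mP ag1.
by have [||] := @a_ramified g^-1 1 _ (prime_gt1 p_pr); rewrite ?rpredV.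
Qed.

Section Bases.
Variables (K : splittingFieldType F) (z : K) (j : {rmorphism K -> W}).
Hypotheses (cK : cyclic_ext p K) (zp : z ^+ p = a%:A) (z_notin : z \notin 1%VS).
Hypothesis j_alg : forall y : F, j y%:A = iota y.
Hypothesis K_poly : forall w : K,
  exists2 q : {poly F}, (size q <= p)%N & w = (map_poly (in_alg K) q).[z].

Lemma norm_image_translate i : t i \in norm_image K.
Proof.
have Nc := galNorm_sub p_pr cK zp z_notin (c i).
rewrite opprK -tE in Nc; apply/norm_imageP; exists ((c i)%:A - z) => //.
by rewrite -(galNorm_eq0 1 {:K}) Nc -in_algE fmorph_eq0.
Qed.

Lemma norm_image_of_power y : y != 0 -> iota y \in powers p H -> y \in norm_image K.
Proof.
move=> y0 /t_span[n /powersP[f _ yf]].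
have f0 : f != 0.
  have : f ^+ p != 0 by rewrite -yf mulf_neq0 // invr_eq0 monomial_neq0.
  by rewrite expf_eq0 p_gt0.
rewrite -(divfK (monomial_neq0 t_neq0 n) y) yf rpredM ?norm_image_exp //.
by apply: rpred_monomial => i _; exact: norm_image_translate.
Qed.

Lemma norm_image_class y : y \in norm_image K ->
  exists k : nat, iota (y / b (inl tt) ^+ k) \in powers p H.
Proof.
have := ramified_norm mP p_pr xiP maxH iotaH xi_sep a_ramified cK zp z_notin j_alg K_poly.
by rewrite opprK; apply.
Qed.

Lemma ramified_norm_basis :
  basis_mod p (predC1 0) (norm_image K) (b \o inr).
Proof.
have iota_xiP : p.-primitive_root (iota xi) by rewrite fmorph_primitive_root.
have [_ bH_indep bH_span] :=
  maximal_basis mP p_pr iota_xiP maxH (iotaH xi) xi_sep GH G0 G_lead b_basis.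
split=> [d|n /norm_image_class[k bn] d|y y0]; first exact: b_neq0.
  pose n' : {malg int[(unit + D)%type]} := push_exponents inr n - << k%:Z *g inl tt >>.
  have : monomial (iota \o b) n' \in powers p H.
    rewrite -rmorph_monomial monomialB // monomialU monomial_push //.
  move=> /bH_indep/(_ (inr d)); rewrite mcoeffB mcoeffU mulr0n subr0 mcoeff_push //.
  by move=> ? ? [].
have [|n yn] := bH_span (iota y); first by rewrite !inE iotaH fmorph_eq0.
rewrite -rmorph_monomial -fmorph_div in yn.
have yn0 : y / monomial b n != 0 by rewrite mulf_neq0 ?invr_eq0 ?monomial_neq0.
exists (right_exponents n); rewrite -(divfK (monomial_neq0 b_neq0 n) y).
rewrite [X in _ / _ * X](monomial_sum_type b_neq0) mulrA mulfK; last first.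
  by apply: monomial_neq0 => d; exact: b_neq0.
apply: rpredM; first exact: norm_image_of_power.
apply: rpred_monomial => -[] _ /=.
by rewrite -t_e0; exact: norm_image_translate.
Qed.

Lemma ramified_power_basis : basis_mod p (norm_image K) (powers p predT) t.
Proof.
split=> // [i|y /norm_image_class[k /t_span[n yn]]]; first exact: norm_image_translate.
exists (n + << k%:Z *g e0 >>); rewrite monomialD // monomialU t_e0.
by rewrite [monomial t n * _]mulrC invfM mulrA.
Qed.

End Bases.

Lemma ramified_extension : exists (K : splittingFieldType F) (cK : cyclic_ext p K),
  basis_mod p (predC1 0) (norm_image K) (b \o inr) /\
  basis_mod p (norm_image K) (powers p predT) t.
Proof.
have [alpha alphaP] := closed_field_root (iota a) p_gt0.
have [K [z [j [cK zp jz j_alg K_poly]]]] :=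
  Kummer_extension p_pr xiP ramified_not_power alphaP.
have z_notin := pth_root_notin ramified_not_power zp.
exists K, cK; split; first exact: ramified_norm_basis z_notin j_alg K_poly.
exact: ramified_power_basis z_notin j_alg K_poly.
Qed.

End RamifiedBases.

(* The norms from F(sqrt -1) are the a^2 + b^2, hence squares if F is Pythagorean. *)
Section SumOfSquares.
Variables (W : closedFieldType) (F : fieldType) (iota : {rmorphism F -> W}).
Hypothesis N1_primitive : 2.-primitive_root (-1 : F).
Hypothesis N1_npow : -1 \notin powers 2 (predT : {pred F}).
Hypothesis pythagorean : forall y : F, y ^+ 2 + 1 \in powers 2 predT.

Lemma sum_of_squares_extension :
  exists (K : splittingFieldType F) (cK : cyclic_ext 2 K),
    forall y, y != 0 -> (y \in norm_image K) = (y \in powers 2 predT).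
Proof.
have [alpha alphaP] := closed_field_root (iota (-1)) (isT : 0 < 2)%N.
have [K [z [j [cK zp jz j_alg K_poly]]]] :=
  Kummer_extension (isT : prime 2) N1_primitive N1_npow alphaP.
have z_notin := pth_root_notin N1_npow zp.
exists K, cK => y y0; apply/norm_imageP/powersP => [[w w0]|[x _ yx]]; last first.
  by apply/norm_imageP; rewrite yx norm_image_exp //; move: y0; rewrite yx expf_eq0.
have [q q_size ->] := K_poly w.
rewrite (horner_coef_wide z (n := 2)) ?size_map_poly //.
rewrite !big_ord_recl big_ord0 addr0 /= !coef_map /= expr0 mulr1 expr1.
have [->|q1] := eqVneq q`_1 0.
  rewrite scale0r mul0r addr0 (galNorm_alg cK) => /(fmorph_inj (in_alg K)) <-.
  by exists q`_0.
have -> : (q`_0)%:A + (q`_1)%:A * z = (- q`_1)%:A * ((- (q`_0 / q`_1))%:A - z).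
  rewrite mulrBr -!in_algE -rmorphM mulrNN (mulrC q`_1) divfK // rmorphN /=.
  by rewrite mulNr opprK.
rewrite galNormM (galNorm_alg cK) (galNorm_sub _ cK zp z_notin) //.
rewrite -!in_algE -rmorphM => /(fmorph_inj (in_alg K)) <-.
have /powersP[x _ qx] := pythagorean (- (q`_0 / q`_1)).
by exists (- q`_1 * x) => //; rewrite opprK qx exprMn.
Qed.

End SumOfSquares.

(** * Groups and fields of monomials *)

Definition sum_family (W I J : Type) (c : I -> W) (x : J -> W) (s : I + J) : W :=
  match s with inl i => c i | inr j => x j end.

Section MonomialGroup.
Variables (W : fieldType) (m : W -> Prop) (L : divringClosed W).
Variables (J : choiceType) (x : J -> W).
Hypotheses (mP : val_ideal m) (L_units : forall l, l \in L -> l != 0 -> ~ m l).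
Hypothesis x_neq0 : forall j, x j != 0.
Hypothesis x_indep : forall n, n != 0 -> m (monomial x n) \/ m (monomial x n)^-1.
Implicit Types (A : {pred J}) (n : {malg int[J]}).

Definition monomials A : {pred W} := fun g => `[< exists l n,
  [/\ l \in L, l != 0, forall j, n@_j != 0 -> j \in A & g = l * monomial x n] >].

Lemma monomialsP A g : reflect (exists l n,
  [/\ l \in L, l != 0, forall j, n@_j != 0 -> j \in A & g = l * monomial x n])
  (g \in monomials A).
Proof. exact: asboolP. Qed.

Fact monomials_divr_closed A : divr_closed (monomials A).
Proof.
split=> [|_ _ /monomialsP[l [n [Ll l0 nA ->]]] /monomialsP[l' [n' [Ll' l'0 n'A ->]]]].
  apply/monomialsP; exists 1, 0; rewrite rpred1 oner_neq0 monomial0 mulr1; split=> // j.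
  by rewrite mcoeff0 eqxx.
apply/monomialsP; exists (l / l'), (n - n'); split.
- exact: rpred_div.
- by rewrite mulf_neq0 ?invr_eq0.
- move=> j; rewrite mcoeffB; have [->|/nA//] := eqVneq (n@_j) 0.
  by rewrite sub0r oppr_eq0; exact: n'A.
- by rewrite monomialB // mulf_div.
Qed.

Definition monomial_group A : divClosed W :=
  HB.pack (monomials A) (GRing.isDivClosed.Build W (monomials A) (monomials_divr_closed A)).

Lemma monomial_groupS A B : {subset A <= B} -> {subset monomial_group A <= monomial_group B}.
Proof.
move=> AB g /monomialsP[l [n [Ll l0 nA ->]]]; apply/monomialsP.
by exists l, n; split=> // j /nA /AB.
Qed.

Lemma mem_monomial_group A l : l \in L -> l != 0 -> l \in monomial_group A.
Proof.
move=> Ll l0; apply/monomialsP; exists l, 0; rewrite monomial0 mulr1; split=> // j.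
by rewrite mcoeff0 eqxx.
Qed.

Lemma var_monomial_group A j : j \in A -> x j \in monomial_group A.
Proof.
move=> Aj; apply/monomialsP; exists 1, << j >>; rewrite rpred1 oner_neq0 mul1r monomialU.
split=> // i; rewrite mcoeffU; case: (j =P i) => [<-//|_].
by rewrite mulr0n eqxx.
Qed.

Lemma monomial_group_neq0 A : 0 \notin monomial_group A.
Proof.
apply/negP => /monomialsP[l [n [_ l0 _ /esym/eqP]]].
by rewrite mulf_eq0 (negPf l0) (negPf (monomial_neq0 x_neq0 n)).
Qed.

Lemma val_monomial l n : l \in L -> l != 0 -> n != 0 ->
  m (l * monomial x n) \/ m (l * monomial x n)^-1.
Proof.
move=> Ll l0 /x_indep[mn|mn]; [left|right]; rewrite ?invfM mulrC.
  by apply: (valM mP) => //; apply: L_units; rewrite ?rpredV ?invr_eq0.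
by apply: (valM mP) => //; rewrite invrK; exact: L_units.
Qed.

Lemma vsim1_monomial l n : l \in L -> l != 0 -> vsim m (l * monomial x n) 1 ->
  l = 1 /\ n = 0.
Proof.
move=> Ll l0 ln1; have [nm nmV] := vsim1_unit mP ln1.
have [n0|n0] := eqVneq n 0; last by have [] := val_monomial Ll l0 n0.
split=> //; move/vsim1E: ln1; rewrite n0 monomial0 mulr1 => ml1.
apply/eqP; rewrite -subr_eq0; apply: contraT => l1.
by case: (L_units _ l1 ml1); rewrite rpredB ?rpred1.
Qed.

Lemma monomial_group_lead A g : g \in monomial_group A -> vsim m g 1 -> g = 1.
Proof.
move=> /monomialsP[l [n [Ll l0 _ ->]]] /(vsim1_monomial Ll l0)[-> ->].
by rewrite monomial0 mulr1.
Qed.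

Lemma monomial_decomposition_inj l n l' n' : l \in L -> l != 0 -> l' \in L -> l' != 0 ->
  l * monomial x n = l' * monomial x n' -> l = l' /\ n = n'.
Proof.
move=> Ll l0 Ll' l'0 e; have q0 : l' * monomial x n' != 0.
  by rewrite mulf_neq0 ?monomial_neq0.
have [||/divr1_eq -> /subr0_eq ->] // := @vsim1_monomial (l / l') (n - n') (rpred_div Ll Ll').
  by rewrite mulf_neq0 ?invr_eq0.
by rewrite monomialB // mulf_div e divff //; apply: vsim_refl => //; exact: oner_neq0.
Qed.

Lemma val_monomial_var A j g i : j \notin A -> g \in monomial_group A -> (0 < i)%N ->
  m (g * x j ^+ i) \/ m (g * x j ^+ i)^-1.
Proof.
move=> Aj /monomialsP[l [n [Ll l0 nA ->]]] i_gt0.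
have -> : l * monomial x n * x j ^+ i = l * monomial x (n + << i%:Z *g j >>).
  by rewrite monomialD // monomialU mulrA.
apply: val_monomial => //; apply/eqP => /(congr1 (mcoeff j)).
have nj : n@_j = 0 by apply/eqP; apply: contraNT Aj; exact: nA.
by rewrite mcoeffD mcoeffUU nj add0r mcoeff0 => -[i0]; rewrite i0 in i_gt0.
Qed.

Lemma val_monomial_ramified p u j g i :
    u \in L -> u != 0 -> g \in monomial_group predT -> (0 < i < p)%N ->
  m (g ^+ p * (u * x j) ^+ i) \/ m (g ^+ p * (u * x j) ^+ i)^-1.
Proof.
move=> Lu u0 /monomialsP[l [n [Ll l0 _ ->]]] /andP[i_gt0 ip].
have -> : (l * monomial x n) ^+ p * (u * x j) ^+ i =
    l ^+ p * u ^+ i * monomial x (n *+ p + << i%:Z *g j >>).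
  by rewrite monomialD // monomialMn // monomialU !exprMn mulrACA.
apply: val_monomial; rewrite ?rpredM ?rpredX ?mulf_neq0 ?expf_neq0 //.
apply/eqP => /(congr1 (mcoeff j)).
rewrite mcoeffD mcoeffUU mcoeffMn mcoeff0 -mulr_natr natz => /eqP.
rewrite addrC addr_eq0 -mulNr => /eqP i_mul.
have : (p%:Z %| i%:Z)%Z by rewrite i_mul dvdz_mull.
by rewrite dvdzE /= gtnNdvd.
Qed.

Lemma monomial_field_exists A : exists k : divringClosed W,
  [/\ {subset L <= k}, forall j, j \in A -> x j \in k & dominated m (monomial_group A) k].
Proof.
pose B (k : divringClosed W) : {pred J} := [pred j | (j \in A) && (x j \in k)].
pose R k h := h != 0 -> exists2 g, g \in monomial_group (B k) & vsim m h g.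
have BS (k k' : divringClosed W) : {subset k <= k'} -> {subset B k <= B k'}.
  by move=> kk' j; rewrite !inE => /andP[-> /kk'].
have [k k' h kk' Rh /Rh[g Gg hg]|l Ll l0|k [Lk domk maxk]] := @subfield_Zorn W R L.
- by exists g => //; apply: monomial_groupS Gg; exact: BS.
- by exists l; [exact: mem_monomial_group | exact: vsim_refl].
exists k; split=> // [j Aj|h kh h0]; last first.
  have [g Gg hg] := domk h kh h0; exists g => //.
  by apply: monomial_groupS Gg => j; rewrite inE => /andP[].
apply: contraT => kj; have nBj : j \notin B k by rewrite inE Aj.
suff domk' : dominated m (monomial_group (B (adjoin k (x j)))) (adjoin k (x j)).
  by case/negP: kj; apply: (maxk _ (@sub_adjoin _ k (x j)) domk'); exact: mem_adjoin.
apply: (dominated_adjoin mP (x_neq0 j) domk).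
- by move=> g i; exact: val_monomial_var.
- by apply: monomial_groupS; apply: BS; exact: sub_adjoin.
- by apply: var_monomial_group; rewrite inE Aj mem_adjoin.
Qed.

Lemma monomial_group_basis p (I : choiceType) (c : I -> W) :
  (0 < p)%N -> basis_mod p [predI L & predC1 0] (powers p L) c ->
  basis_mod p (monomial_group predT) (powers p (monomial_group predT)) (sum_family c x).
Proof.
move=> p_gt0 [cL c_indep c_span].
have Lc i : c i \in L /\ c i != 0 by have := cL i; rewrite !inE => /andP.
have s_neq0 s : sum_family c x s != 0 by case: s => [i|j] //=; case: (Lc i).
have monE (n : {malg int[(I + J)%type]}) : monomial (sum_family c x) n =
    monomial c (left_exponents n) * monomial x (right_exponents n).
  exact: monomial_sum_type.
have c_neq0 (n : {malg int[I]}) : monomial c n != 0 by apply: monomial_neq0 => i; case: (Lc i).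
have Lmon (n : {malg int[I]}) : monomial c n \in L by apply: rpred_monomial => i _; case: (Lc i).
split=> [[i|j]|n /powersP[_ /monomialsP[l [n' [Ll l0 _ ->]]]]|_ /monomialsP[l [n [Ll l0 _ ->]]]].
- by case: (Lc i); exact: mem_monomial_group.
- exact: var_monomial_group.
- rewrite monE exprMn -monomialMn // => /monomial_decomposition_inj.
  case=> // [||cl nE]; [exact: rpredX | exact: expf_neq0 |].
  case=> [i|j].
    by rewrite -mcoeff_left; apply: c_indep; rewrite cl mem_powers.
  by rewrite -mcoeff_right nE mcoeffMn -mulr_natr natz dvdz_mull.
have [|n' /powersP[u Lu lu]] := c_span l; first by rewrite !inE Ll.
exists (push_exponents inl n' + push_exponents inr n).
rewrite monomialD // !monomial_push // -mulf_div divff ?monomial_neq0 // mulr1.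
rewrite [X in l / X](_ : _ = monomial c n') // lu; apply: mem_powers.
apply: mem_monomial_group => //; apply: contra_eq_neq lu => ->.
by rewrite expr0n gtn_eqF // mulf_neq0 ?invr_eq0.
Qed.

End MonomialGroup.

Section LinearFactors.
Variables (W : fieldType) (E : choiceType) (r : E -> W).
Hypothesis r_inj : injective r.

Lemma mup_exp a (f : {poly W}) n : f != 0 -> mup a (f ^+ n) = (n * mup a f)%N.
Proof.
move=> f0; elim: n => [|n IH]; first by rewrite expr0 mupNroot // root1.
by rewrite exprS mupM ?expf_neq0 // IH mulSn.
Qed.

Lemma mup_prod_XsubC_exp (s : seq E) (e : E -> nat) i : uniq s -> i \in s ->
  mup (r i) (\prod_(l <- s) ('X - (r l)%:P) ^+ e l) = e i.
Proof.
move=> s_uniq si; rewrite (bigD1_seq i) //= mupMl.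
  by rewrite mup_XsubCX eqxx.
rewrite rootE horner_prod prodf_seq_neq0; apply/allP => l _; apply/implyP => li.
by rewrite !hornerE expf_neq0 // subr_eq0 (inj_eq r_inj) eq_sym.
Qed.

(* The x - r i are distinct primes of k[x]. *)
Lemma indep_mod_transcendental p (k : divringClosed W) (x : W) :
    (0 < p)%N -> (forall f, f \is a polyOver k -> f != 0 -> f.[x] != 0) ->
    (forall i, r i \in k) ->
  indep_mod p (powers p (adjoin k x)) (fun i => x - r i).
Proof.
move=> p_gt0 x_transc kr n /powersP[_ /adjoinP[f [g [kf kg gx0 ->]]] nE] i.
have [->|ni] := eqVneq (n@_i) 0; first exact: dvdz0.
pose num (z : int) := if z is Posz a then a else 0%N.
have numB z : z = (num z)%:Z - (num (- z))%:Z.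
  by case: z => [[|a]|a] //=; rewrite ?subr0 // NegzE sub0r.
pose P (e : E -> nat) : {poly W} := \prod_(l <- msupp n) ('X - (r l)%:P) ^+ e l.
pose pos l := num n@_l; pose neg l := num (- n@_l).
have P0 e : P e != 0.
  by rewrite prodf_seq_neq0; apply/allP => l _; rewrite expf_neq0 ?polyXsubC_eq0.
have kP e : P e \is a polyOver k.
  by apply: rpred_prod => l _; rewrite rpredX // rpredB ?polyOverX // polyOverC.
have Px0 e : (P e).[x] != 0 by exact: x_transc.
have x_neq l : x - r l != 0.
  have := x_transc ('X - (r l)%:P); rewrite !hornerE; apply; last by rewrite polyXsubC_eq0.
  by rewrite rpredB ?polyOverX // polyOverC.
have nPE : monomial (fun i => x - r i) n = (P pos).[x] / (P neg).[x].
  rewrite /P !horner_prod -prodf_div; apply: eq_bigr => l _.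
  by rewrite !hornerE [in LHS](numB n@_l) expfzDr // -exprnN.
have fgE : P pos * g ^+ p = f ^+ p * P neg.
  apply/eqP; rewrite -subr_eq0; apply: contraT => /x_transc.
  rewrite rpredB ?rpredM ?rpredX // => /(_ isT).
  rewrite !hornerE subr_eq0 -(divfK (Px0 neg) (P pos).[x]) -nPE nE expr_div_n.
  by rewrite mulrAC divfK ?expf_neq0 // eqxx.
have g0 : g != 0 by apply: contraNneq gx0 => ->; rewrite horner0.
have f0 : f != 0.
  have : f ^+ p != 0.
    have : P pos * g ^+ p != 0 by rewrite mulf_neq0 ?expf_neq0.
    by rewrite fgE mulf_eq0 negb_or => /andP[].
  by rewrite expf_eq0 p_gt0.
have /(congr1 (mup (r i))) := fgE.
rewrite !mupM ?expf_neq0 // !mup_exp // !mup_prod_XsubC_exp -?mcoeff_neq0 ?fset_uniq //.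
move=> fg; rewrite (numB n@_i) -/(pos i) -/(neg i).
have -> : (pos i)%:Z - (neg i)%:Z = (mup (r i) f)%:Z * p%:Z - (mup (r i) g)%:Z * p%:Z by lia.
by rewrite -mulrBl dvdz_mull.
Qed.

End LinearFactors.

(** * Ultrapowers *)

Section Ultrapower.
Variables (C : closedFieldType) (S : pointedType) (U : set_system S).
Hypothesis UU : UltraFilter U.
Local Open Scope classical_set_scope.
Local Open Scope ring_scope.
Implicit Types f g : S -> C.

Definition null_functions of UltraFilter U : {pred (S -> C)} :=
  fun f => `[< U [set s | f s = 0] >].

Fact null_functions_idealr_closed : idealr_closed (null_functions UU).
Proof.
split=> [|| a f g /asboolP f0 /asboolP g0].
- by apply/asboolP; exact: filterE.
- apply/asboolP => one0; have [s /= /eqP] := filter_ex one0.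
  by rewrite /cst oner_eq0.
- apply/asboolP; apply: filterS2 f0 g0 => s /= fs gs.
  by rewrite [LHS](_ : _ = a s * f s + g s) // fs gs mulr0 addr0.
Qed.

HB.instance Definition _ := isIdealr.Build (S -> C) (null_functions UU)
  null_functions_idealr_closed.

Definition ultrapower := {ideal_quot (null_functions UU)}.
HB.instance Definition _ := GRing.ComNzRing.on ultrapower.

Definition ultra_class : (S -> C) -> ultrapower := \pi_ultrapower%qT.
HB.instance Definition _ := GRing.RMorphism.on ultra_class.

Definition ultra_repr (z : ultrapower) : S -> C := repr z.

Lemma ultra_reprK z : ultra_class (ultra_repr z) = z.
Proof. exact: reprK. Qed.

Lemma ultra_classP f g : ultra_class f = ultra_class g <-> U [set s | f s = g s].
Proof.
have -> : [set s | f s = g s] = [set s | (f - g) s = 0].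
  apply/seteqP; split=> s /= => [fgs|/subr0_eq //].
  by rewrite [LHS](_ : _ = f s - g s) // fgs subrr.
split=> [/eqP|fg]; first by rewrite -Quotient.idealrBE => /asboolP.
by apply/eqP; rewrite -Quotient.idealrBE; apply/asboolP.
Qed.

Lemma ultra_reprE f : U [set s | ultra_repr (ultra_class f) s = f s].
Proof. by apply/ultra_classP; rewrite ultra_reprK. Qed.

Lemma ultra_class_neq0 f : ultra_class f != 0 <-> U [set s | f s != 0].
Proof.
rewrite -(rmorph0 ultra_class); split=> [f0|f0].
  have [f0'|] := in_ultra_setVsetC [set s | f s = 0] UU.
    by case/eqP: f0; apply/ultra_classP.
  by apply: filterS => s /= /eqP.
apply/eqP => /ultra_classP f0'; have [s /= [/eqP]] := filter_ex (filterI f0 f0').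
by [].
Qed.

Definition ultra_inv (z : ultrapower) : ultrapower := ultra_class (fun s => (ultra_repr z s)^-1).

Fact ultra_mulV (z : ultrapower) : z != 0 -> ultra_inv z * z = 1.
Proof.
rewrite -[in _ != 0](ultra_reprK z) => /ultra_class_neq0 z0.
rewrite /ultra_inv -[X in _ * X]ultra_reprK -rmorphM -(rmorph1 ultra_class).
by apply/ultra_classP; apply: filterS z0 => s /= zs; exact: mulVf.
Qed.

Fact ultra_inv0 : ultra_inv 0 = 0.
Proof.
rewrite -(rmorph0 ultra_class); apply/ultra_classP.
by apply: filterS (ultra_reprE 0) => s /= ->; exact: invr0.
Qed.

HB.instance Definition _ := GRing.ComNzRing_isField.Build ultrapower ultra_mulV ultra_inv0.

Lemma ultra_classV f : ultra_class (fun s => (f s)^-1) = (ultra_class f)^-1.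
Proof.
by apply/esym/ultra_classP; apply: filterS (ultra_reprE f) => s /= ->.
Qed.

Lemma ultra_classX f n : ultra_class (fun s => f s ^+ n) = ultra_class f ^+ n.
Proof.
rewrite -rmorphXn; congr ultra_class; apply/funext => s.
by elim: n => // n IH; rewrite !exprS IH.
Qed.

Lemma ultra_classXz f (n : int) : ultra_class (fun s => f s ^ n) = ultra_class f ^ n.
Proof.
case: n => n; first exact: ultra_classX.
by rewrite [RHS](_ : _ = (ultra_class f ^+ n.+1)^-1) // -ultra_classX -ultra_classV.
Qed.

Lemma ultra_class_prod I (r : seq I) (f : I -> S -> C) :
  ultra_class (fun s => \prod_(i <- r) f i s) = \prod_(i <- r) ultra_class (f i).
Proof. by rewrite -rmorph_prod; congr ultra_class; apply/funext => s; rewrite fct_prodE. Qed.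

Fact ultrapower_closed : GRing.closed_field_axiom ultrapower.
Proof.
move=> n P n_gt0.
have /choice[f fP] : forall s, exists y : C, y ^+ n = \sum_(i < n) ultra_repr (P i) s * y ^+ i.
  by move=> s; exact: (@solve_monicpoly C n (fun i => ultra_repr (P i) s) n_gt0).
exists (ultra_class f); rewrite -ultra_classX (funext fP).
under [RHS]eq_bigr => i _ do rewrite -(ultra_reprK (P i)) -ultra_classX -rmorphM.
by rewrite -rmorph_sum; congr ultra_class; apply/funext => s; rewrite fct_sumE.
Qed.

HB.instance Definition _ := Field_isAlgClosed.Build ultrapower ultrapower_closed.

Definition ultra_const (a : C) : ultrapower := ultra_class (cst a).

Fact ultra_const_zmod_morphism : zmod_morphism ultra_const.
Proof. by move=> a b; rewrite /ultra_const -rmorphB. Qed.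

Fact ultra_const_monoid_morphism : monoid_morphism ultra_const.
Proof.
split=> [|a b]; first exact: (rmorph1 ultra_class).
by rewrite /ultra_const -rmorphM.
Qed.

HB.instance Definition _ :=
  GRing.isZmodMorphism.Build C ultrapower ultra_const ultra_const_zmod_morphism.
HB.instance Definition _ :=
  GRing.isMonoidMorphism.Build C ultrapower ultra_const ultra_const_monoid_morphism.

Lemma ultra_finite (T : finType) (g : S -> T) : exists t, U [set s | g s = t].
Proof.
apply: contrapT => /forallNP ng.
have [s gs] : exists s, (\bigcap_(t in [set` [fset t in enum T]%fset]) [set s | g s <> t]) s.
  apply: (@filter_ex _ U); apply: filter_bigI => t _.
  by have [/ng|] := in_ultra_setVsetC [set s | g s = t] UU.
by apply: (gs (g s)) => //=; rewrite in_fset mem_enum.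
Qed.

End Ultrapower.

(** * A valued field of large rank *)

(* An ultrafilter will make [labels] and [vars] contain any given finite set,
   [gap] exceed any integer and [base] exceed any function of [labels].  Then the
   elements base ^ (gap ^ k), with k the position of a variable in [vars], have
   the property that a nontrivial monomial in them is infinite or infinitesimal
   with respect to the functions of [labels]. *)
Record scale (E J : Type) := Scale { labels : seq E; vars : seq J; base : nat; gap : nat }.

HB.instance Definition _ (E J : Type) := gen_eqMixin (scale E J).
HB.instance Definition _ (E J : Type) := gen_choiceMixin (scale E J).
HB.instance Definition _ (E J : Type) := isPointed.Build (scale E J) (Scale [::] [::] 0 0).

Section Scales.
Local Open Scope classical_set_scope.
Local Open Scope ring_scope.
Variables (E J : choiceType).
Implicit Types (s : scale E J) (f : seq E -> algC).

Definition scale_filter : set_system (scale E J) := [set A |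
  exists (l0 : seq E) (v0 : seq J) g0 f, forall s,
    {subset l0 <= labels s} -> {subset v0 <= vars s} -> (g0 <= gap s)%N ->
    `|f (labels s)| <= (base s)%:R -> A s].

Lemma scale_filter_proper : ProperFilter scale_filter.
Proof.
apply: Build_ProperFilter_ex.
  move=> A [l0 [v0 [g0 [f sA]]]].
  exists (Scale l0 v0 (Num.bound `|f l0|) g0); apply: sA => //=.
  by apply: ltW; apply: archi_boundP.
split.
- by exists [::], [::], 0%N, (fun=> 0).
- move=> A B [l0 [v0 [g0 [f sA]]]] [l1 [v1 [g1 [f' sB]]]].
  exists (l0 ++ l1), (v0 ++ v1), (maxn g0 g1), (fun l => `|f l| + `|f' l|) => s.
  move=> l_sub v_sub; rewrite geq_max => /andP[g0s g1s].
  rewrite ger0_norm ?addr_ge0 // => f_le.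
  split; [apply: sA | apply: sB] => //.
  + by move=> i il; apply: l_sub; rewrite mem_cat il.
  + by move=> i il; apply: v_sub; rewrite mem_cat il.
  + by apply: le_trans f_le; rewrite lerDl.
  + by move=> i il; apply: l_sub; rewrite mem_cat il orbT.
  + by move=> i il; apply: v_sub; rewrite mem_cat il orbT.
  + by apply: le_trans f_le; rewrite lerDr.
- by move=> A B AB [l0 [v0 [g0 [f sA]]]]; exists l0, v0, g0, f => s *; apply/AB/sA.
Qed.

Section Model.
Variable U : set_system (scale E J).
Hypotheses (UU : UltraFilter U) (FU : scale_filter `<=` U).

Lemma labels_large (l0 : seq E) : U [set s | {subset l0 <= labels s}].
Proof. by apply: FU; exists l0, [::], 0%N, (fun=> 0). Qed.

Lemma vars_large (v0 : seq J) : U [set s | {subset v0 <= vars s}].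
Proof. by apply: FU; exists [::], v0, 0%N, (fun=> 0). Qed.

Lemma gap_large g0 : U [set s | (g0 <= gap s)%N].
Proof. by apply: FU; exists [::], [::], g0, (fun=> 0). Qed.

Lemma base_large f : U [set s | `|f (labels s)| <= (base s)%:R].
Proof. by apply: FU; exists [::], [::], 0%N, f. Qed.

Lemma base_gt1 : U [set s | (1 < base s)%N].
Proof. by apply: filterS (base_large (fun=> 2)) => s /=; rewrite normr_nat ler_nat. Qed.

Local Notation W := (ultrapower algC UU).
Local Notation cls := (@ultra_class algC _ _ UU).

Definition infinitesimal (z : W) :=
  forall f, U [set s | `|f (labels s) * ultra_repr z s| <= 1].

Lemma infinitesimalP h : infinitesimal (cls h) <->
  forall f, U [set s | `|f (labels s) * h s| <= 1].
Proof.
split=> small f; apply: filterS2 (small f) (ultra_reprE UU h) => s /= fs hs.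
  by rewrite -hs.
by rewrite hs.
Qed.

Lemma ultra_class_ind (P : W -> Prop) : (forall h, P (cls h)) -> forall z, P z.
Proof. by move=> Ph z; rewrite -(ultra_reprK z). Qed.

Lemma infinitesimalD y z : infinitesimal y -> infinitesimal z -> infinitesimal (y + z).
Proof.
elim/ultra_class_ind: y => g; elim/ultra_class_ind: z => h.
move=> /infinitesimalP g_small /infinitesimalP h_small; rewrite -rmorphD; apply/infinitesimalP => f.
apply: filterS2 (g_small (fun l => 2 * f l)) (h_small (fun l => 2 * f l)) => s /=.
rewrite -[(g + h) s]/(g s + h s) -!mulrA !(normrM 2) !normr_nat => gs hs.
rewrite -(ler_pM2l (ltr0n _ 2)) mulr1 mulrDr.
apply: le_trans (_ : 2 * (`|f (labels s) * g s| + `|f (labels s) * h s|) <= _).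
  by rewrite ler_pM2l ?ltr0n // ler_normD.
by rewrite mulrDr -[X in _ <= X]/(1 + 1); apply: lerD.
Qed.

Lemma infinitesimalM y z : infinitesimal y -> ~ infinitesimal z^-1 -> infinitesimal (y * z).
Proof.
elim/ultra_class_ind: y => g; elim/ultra_class_ind: z => h.
rewrite -ultra_classV -rmorphM => /infinitesimalP g_small /infinitesimalP.
move=> /existsNP[f0 nf0]; apply/infinitesimalP => f.
have [//|f0_gt] := in_ultra_setVsetC [set s | `|f0 (labels s) / h s| <= 1] UU.
apply: filterS2 f0_gt (g_small (fun l => f l * f0 l)) => s /= /negP.
rewrite -real_ltNge ?rpred1 ?normr_real // => f0h g_le.
rewrite -[(g * h) s]/(g s * h s).
have h0 : h s != 0 by apply: contraTneq f0h => ->; rewrite invr0 mulr0 normr0 ltr10.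
have hf0 : `|h s| <= `|f0 (labels s)|.
  by move: f0h; rewrite normrM normfV ltr_pdivlMr ?normr_gt0 // mul1r => /ltW.
apply: le_trans g_le; rewrite mulrA [f _ * f0 _ * _]mulrAC !normrM.
by rewrite ler_wpM2l // mulr_ge0.
Qed.

Lemma infinitesimalV y : infinitesimal y -> y != 0 -> ~ infinitesimal y^-1.
Proof.
elim/ultra_class_ind: y => g; rewrite -ultra_classV.
move=> /infinitesimalP g_small /ultra_class_neq0 g0 /infinitesimalP gV_small.
have [s /= [[gs g_le] gV_le]] :=
  filter_ex (filterI (filterI g0 (g_small (fun=> 2))) (gV_small (fun=> 2))).
have : `|2 * g s| * `|2 / g s| <= 1 by rewrite mulr_ile1.
by rewrite -normrM mulrACA mulfV // mulr1 -natrM normr_nat lern1.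
Qed.

Lemma infinitesimal_val : val_ideal infinitesimal.
Proof.
split; [| |exact: infinitesimalD|exact: infinitesimalM|exact: infinitesimalV].
  rewrite -(rmorph0 cls); apply/infinitesimalP => f; apply: filterE => s /=.
  by rewrite [X in _ * X](_ : _ = 0) // mulr0 normr0 ler01.
rewrite -(rmorph1 cls) => /infinitesimalP /(_ (fun=> 2)) /filter_ex[s /=].
by rewrite [X in _ * X](_ : _ = 1) // mulr1 normr_nat lern1.
Qed.

Definition variable (j : J) : W := cls (fun s => (base s)%:R ^+ (gap s ^ index j (vars s))).

Lemma variable_neq0 j : variable j != 0.
Proof.
apply/ultra_class_neq0; apply: filterS base_gt1 => s /= s_gt1.
by rewrite expf_neq0 // pnatr_eq0 -lt0n ltnW.
Qed.

Definition total_exponent (n : {malg int[J]}) s : int :=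
  \sum_(j <- msupp n) (gap s ^ index j (vars s))%:Z * n@_j.

Lemma total_exponent_neq0 n s : n != 0 -> {subset msupp n <= vars s} ->
  (forall j, (`|n@_j| < gap s)%N) -> total_exponent n s != 0.
Proof.
move=> n0 n_vars n_gap.
pose P i := has (fun j => index j (vars s) == i) (msupp n).
have exP : exists i, P i.
  have [j nj] : exists j, j \in msupp n.
    apply: contrapT => /forallNP n_empty; case/eqP: n0; apply/malgP => j.
    by rewrite mcoeff0; case: msuppP => // /n_empty.
  by exists (index j (vars s)); apply/hasP; exists j.
have [i /hasP[j nj /eqP ij] i_min] := ex_minnP exP.
apply: contraTneq (n_gap j) => e0; rewrite -leqNgt.
apply: dvdn_leq; first by rewrite absz_gt0 mcoeff_neq0.
have gap_gt0 : (0 < gap s)%N by apply: leq_trans (n_gap j).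
have : ((gap s ^ i.+1)%:Z %| (gap s ^ i)%:Z * n@_j)%Z.
  have : ((gap s ^ i.+1)%:Z %| total_exponent n s)%Z by rewrite e0 dvdz0.
  rewrite /total_exponent (bigD1_seq j) ?fset_uniq //= ij rpredDr // big_seq_cond.
  apply: rpred_sum => k /andP[nk kj].
  apply: dvdz_mulr; rewrite dvdzE /= dvdn_exp2l // ltn_neqAle.
  rewrite i_min ?andbT; last by apply/hasP; exists k.
  rewrite -ij; apply: contraNneq kj => e; apply/eqP.
  by rewrite -(nth_index j (n_vars k nk)) -e nth_index // n_vars.
by rewrite dvdzE abszM /= expnSr dvdn_pmul2l // expn_gt0 gap_gt0.
Qed.

Lemma monomial_variable n :
  monomial variable n = cls (fun s => (base s)%:R ^ total_exponent n s).
Proof.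
rewrite /monomial /variable; under eq_bigr => j _ do rewrite -ultra_classXz.
rewrite -ultra_class_prod; apply/ultra_classP; apply: filterS base_gt1 => s /= s_gt1.
have base0 : (base s)%:R != 0 :> algC by rewrite pnatr_eq0 -lt0n ltnW.
rewrite /total_exponent; elim: (enum_fset (msupp n)) => [|j v IH].
  by rewrite !big_nil expr0z.
by rewrite !big_cons expfzDr // -IH -exprz_exp.
Qed.

Lemma negative_power_small (e : scale E J -> int) : U [set s | e s < 0] ->
  infinitesimal (cls (fun s => (base s)%:R ^ e s)).
Proof.
move=> e_lt0; apply/infinitesimalP => f.
apply: filterS2 (filterI e_lt0 base_gt1) (base_large f) => s /= [es s_gt1] f_le.
have base0 : 0 < (base s)%:R :> algC by rewrite ltr0n ltnW.
have pow_ge0 : 0 <= (base s)%:R ^ e s :> algC by rewrite exprz_ge0 // ltW.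
rewrite normrM (ger0_norm pow_ge0).
apply: (@le_trans _ _ ((base s)%:R * (base s)%:R ^ (-1))); last first.
  by rewrite exprN1 mulfV // gt_eqF.
apply: ler_pM => //; case: (e s) es => // k _.
rewrite exprN1 -[_ ^ _]/((base s)%:R ^- k.+1).
by rewrite lef_pV2 ?posrE ?exprn_gt0 // ler_eXnr // ler1n ltnW.
Qed.

Lemma variable_indep n : n != 0 ->
  infinitesimal (monomial variable n) \/ infinitesimal (monomial variable n)^-1.
Proof.
move=> n0; rewrite monomial_variable -ultra_classV.
have e_neq0 : U [set s | total_exponent n s != 0].
  pose g0 := \sum_(j <- msupp n) `|n@_j|%N.
  apply: filterS2 (vars_large (msupp n)) (gap_large g0.+1) => s /= n_vars g0s.
  apply: total_exponent_neq0 => // j; apply: leq_trans g0s; rewrite ltnS.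
  by case: msuppP => // nj; rewrite /g0 (bigD1_seq j) ?fset_uniq //= leq_addr.
have [e_lt0|e_ge0] := in_ultra_setVsetC [set s | total_exponent n s < 0] UU.
  by left; exact: negative_power_small.
right; rewrite (_ : (fun s => _) = (fun s => (base s)%:R ^ (- total_exponent n s))).
  by apply: negative_power_small; apply: filterS2 e_ge0 e_neq0 => s /=; lia.
by apply/funext => s; rewrite -invr_expz.
Qed.

Definition slow f : W := cls (fun s => f (labels s)).

Lemma slowX f k : slow (fun l => f l ^+ k) = slow f ^+ k.
Proof. exact: ultra_classX. Qed.

Lemma slow_unit f : slow f != 0 -> ~ infinitesimal (slow f).
Proof.
move=> /ultra_class_neq0 f0 /infinitesimalP /(_ (fun l => 2 / f l)) f_small.
have [s /= [fs]] := filter_ex (filterI f0 f_small).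
by rewrite divfK // normr_nat lern1.
Qed.

Variable e0 : E.

Definition label i : W := slow (fun l => (index i (e0 :: l))%:R).

Lemma label_e0 : label e0 = 0.
Proof. by rewrite -(rmorph0 cls); congr cls; apply/funext => s /=; rewrite eqxx. Qed.

Lemma label_exp_inj p : (0 < p)%N -> injective (fun i => label i ^+ p).
Proof.
move=> p_gt0 i i'; rewrite -!slowX => /ultra_classP ii'.
have [s [/= sub /eqP]] := filter_ex (filterI (labels_large [:: i; i']) ii').
rewrite -!natrX eqr_nat eqn_exp2r // => /eqP ind.
have mem_s k : k \in [:: i; i'] -> k \in e0 :: labels s.
  by move=> /sub ks; rewrite in_cons ks orbT.
have i_s : i \in e0 :: labels s by rewrite mem_s ?mem_head.
have i'_s : i' \in e0 :: labels s by rewrite mem_s // !inE eqxx orbT.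
by rewrite -(nth_index e0 i_s) -[RHS](nth_index e0 i'_s); congr nth.
Qed.

Section SlowField.
Variable k0 : divringClosed algC.

Definition slow_field : {pred W} :=
  fun z => `[< exists2 f, (forall l, f l \in k0) & z = slow f >].

Lemma slow_fieldP z :
  reflect (exists2 f, (forall l, f l \in k0) & z = slow f) (z \in slow_field).
Proof. exact: asboolP. Qed.

Fact slow_field_divring_closed : divring_closed slow_field.
Proof.
split=> [|_ _ /slow_fieldP[f fL ->] /slow_fieldP[g gL ->]|
          _ _ /slow_fieldP[f fL ->] /slow_fieldP[g gL ->]]; apply/slow_fieldP.
- by exists (fun=> 1) => [l|]; [exact: rpred1 | rewrite -(rmorph1 cls)].
- by exists (fun l => f l - g l) => [l|]; [exact: rpredB | rewrite -rmorphB].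
- exists (fun l => f l / g l) => [l|]; first exact: rpred_div.
  by rewrite -ultra_classV -rmorphM.
Qed.

HB.instance Definition _ :=
  GRing.isDivringClosed.Build W slow_field slow_field_divring_closed.

Lemma slow_field_units z : z \in slow_field -> z != 0 -> ~ infinitesimal z.
Proof. by move=> /slow_fieldP[f _ ->]; exact: slow_unit. Qed.

Lemma const_slow_field a : a \in k0 -> ultra_const UU a \in slow_field.
Proof. by move=> La; apply/slow_fieldP; exists (fun=> a). Qed.

Lemma label_slow_field i : label i \in slow_field.
Proof.
apply/slow_fieldP; exists (fun l => (index i (e0 :: l))%:R) => // l.
exact: rpred_nat.
Qed.

Lemma const_powers p a :
  ultra_const UU a \in powers p slow_field -> a \in powers p k0.
Proof.
move=> /powersP[_ /slow_fieldP[f fL ->]]; rewrite -slowX => /ultra_classP/filter_ex[s af].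
have {}af : a = f (labels s) ^+ p by [].
by rewrite af mem_powers.
Qed.

Lemma slow_field_pythagorean : (forall a, a \in k0 -> a ^+ 2 + 1 \in powers 2 k0) ->
  forall z, z \in slow_field -> z ^+ 2 + 1 \in powers 2 slow_field.
Proof.
move=> k0_pyth _ /slow_fieldP[f fL ->].
have /choice[g gP] l : exists y, y \in k0 /\ f l ^+ 2 + 1 = y ^+ 2.
  by have /powersP[y] := k0_pyth _ (fL l); exists y.
apply/powersP; exists (slow g); first by apply/slow_fieldP; exists g => // l; case: (gP l).
rewrite -!slowX -(rmorph1 cls) -rmorphD; congr cls; apply/funext => s.
by case: (gP (labels s)).
Qed.

Lemma slow_field_basis p (I : finType) (c : I -> algC) : (0 < p)%N ->
  basis_mod p [predI k0 & predC1 0] (powers p k0) c ->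
  basis_mod p [predI slow_field & predC1 0] (powers p slow_field) (ultra_const UU \o c).
Proof.
move=> p_gt0 [cL c_indep c_span].
have Lc i : c i \in k0 /\ c i != 0 by have := cL i; rewrite !inE => /andP.
split=> [i|n|_ /andP[/slow_fieldP[f fL ->] /ultra_class_neq0 f0]].
- by case: (Lc i) => Lci ci0; rewrite !inE const_slow_field // fmorph_eq0.
- by rewrite -rmorph_monomial => /const_powers/c_indep.
have /choice[ky kyP] l : exists ky : {ffun I -> 'I_p} * algC,
    f l != 0 -> ky.2 \in k0 /\ f l = \prod_i c i ^+ ky.1 i * ky.2 ^+ p.
  have [->|fl0] := eqVneq (f l) 0; first by exists ([ffun=> Ordinal p_gt0], 0).
  have [i|i||k [y Ly fE]] := @span_mod_finite _ _ k0 _ c (f l) p_gt0.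
  - by case: (Lc i).
  - by case: (Lc i).
  - by apply: c_span; rewrite !inE fL.
  - by exists (k, y).
have [k k_eq] := ultra_finite UU (fun s => (ky (labels s)).1).
pose y l := if f l != 0 then (ky l).2 else 0.
pose n : {malg int[I]} := \sum_i << (k i : nat)%:Z *g i >>.
have c_neq0 i : c i != 0 by case: (Lc i).
exists n; apply/powersP; exists (slow y).
  by apply/slow_fieldP; exists y => // l; rewrite /y; case: ifP => [/kyP[]|]; rewrite ?rpred0.
rewrite -rmorph_monomial; have mon0 : ultra_const UU (monomial c n) != 0.
  by rewrite fmorph_eq0 monomial_neq0.
apply: (canLR (mulfK mon0)); rewrite -slowX mulrC /ultra_const /slow -rmorphM.
apply/ultra_classP; apply: filterS2 f0 k_eq => s /= fs ks.
have [_ fE] := kyP _ fs; rewrite [RHS](_ : _ = monomial c n * y (labels s) ^+ p) //.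
rewrite [LHS]fE /y fs ks monomial_sum //; congr (_ * _).
by apply: eq_bigr => i _; rewrite monomialU.
Qed.

End SlowField.
End Model.
End Scales.

(** * Realization of the invariants *)

Definition realizes (p : nat) (p_pr : prime p) (D E : Type) (Y : nat) : Prop :=
  exists (F : fieldType) (xi : F) (K : splittingFieldType F) (cK : cyclic_ext p K),
    [/\ p.-primitive_root xi, has_dim (d_space p_pr cK) D,
        has_dim (e_space K p_pr) E & Upsilon K xi = Y].

Section ValuedMonomials.
Variables (W : closedFieldType) (m : W -> Prop) (L : divringClosed W).
Variables (J : choiceType) (x : J -> W).
Hypotheses (mP : val_ideal m) (L_units : forall l, l \in L -> l != 0 -> ~ m l).
Hypothesis x_neq0 : forall j, x j != 0.
Hypothesis x_indep : forall n, n != 0 -> m (monomial x n) \/ m (monomial x n)^-1.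

Let G := monomial_group L x_neq0 predT.

Lemma maximal_monomial_field_exists (k : divringClosed W) :
    {subset L <= k} -> (forall j, x j \in k) -> dominated m G k ->
  exists H : divringClosed W,
    [/\ {subset k <= H}, {subset G <= H} & maximal_dominated m G H].
Proof.
move=> Lk xk domk; have [H [kH maxH]] := maximal_dominated_exists domk.
exists H; split=> // g /monomialsP[l [n [Ll _ _ ->]]].
by apply: kH; rewrite rpredM ?(Lk l) // rpred_monomial.
Qed.

Lemma root_of_unity_separated p (xi : W) i : p.-primitive_root xi -> xi \in L ->
  (0 < i < p)%N -> ~ m (1 - xi ^+ i).
Proof.
move=> xiP Lxi /andP[i_gt0 ip]; apply: L_units; first by rewrite rpredB ?rpred1 ?rpredX.
by rewrite subr_eq0 eq_sym -(prim_order_dvd xiP) gtnNdvd.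
Qed.

Section Pythagorean.
Hypothesis L_npow : -1 \notin powers 2 L.
Hypothesis L_pyth : forall l, l \in L -> l ^+ 2 + 1 \in powers 2 L.

Lemma N1_primitive : 2.-primitive_root (-1 : W).
Proof.
apply/andP; split=> //; apply/forallP => -[[|[|i]] i_lt2] //=.
  rewrite unity_rootE expr1 eqbF_neg; apply: contra L_npow => /eqP ->.
  by rewrite -(expr1n _ 2) mem_powers ?rpred1.
by rewrite unity_rootE sqrrN expr1n !eqxx.
Qed.

Variable H : divringClosed W.
Hypotheses (LH : {subset L <= H}) (maxH : maximal_dominated m G H).

Let LN1 : -1 \in L. Proof. by rewrite rpredN rpred1. Qed.

Let sq_neqN1 l : l \in L -> l ^+ 2 + 1 != 0.
Proof. by move=> Ll; apply: contra L_npow; rewrite addr_eq0 => /eqP <-; exact: mem_powers. Qed.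

Lemma vsim_square h g : h \in H -> g \in H -> vsim m h (g ^+ 2) -> h \in powers 2 H.
Proof.
apply: (vsim_power mP _ N1_primitive maxH (LH LN1)) => // i.
exact: root_of_unity_separated N1_primitive LN1.
Qed.

Lemma pythagorean_maximal h : h \in H -> h ^+ 2 + 1 \in powers 2 H.
Proof.
move=> Hh; have Hh2 : h ^+ 2 + 1 \in H by rewrite rpredD ?rpredX ?rpred1.
have [->|h0] := eqVneq h 0.
  by rewrite expr0n add0r -(expr1n _ 2) mem_powers ?rpred1.
have [_ /monomialsP[l [n [Ll l0 _ ->]]] hl] := maxH.1 h Hh h0.
have [n0|n0] := eqVneq n 0; last first.
  have g0 : l * monomial x n != 0 by rewrite mulf_neq0 ?monomial_neq0.
  have [mg|mg] := val_monomial mP L_units x_indep Ll l0 n0.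
    apply: (vsim_square Hh2 (rpred1 H)); rewrite addrC expr1n; apply: vsim_addr.
    have h1 : vlt m h 1 by apply: (vlt_siml mP hl); apply/vltx1.
    by rewrite expr2 -[X in vlt m _ X]mulr1; exact: vltM.
  apply: (vsim_square Hh2 Hh); apply: vsim_addr.
  have h1 : vlt m 1 h.
    by apply: (vlt_simr mP (y := l * monomial x n)); [split; rewrite ?mul1r | exact: vsim_sym].
  by rewrite expr2 -[X in vlt m X _]mulr1; exact: vltM.
rewrite n0 monomial0 mulr1 in hl; have /powersP[y Ly yl] := L_pyth Ll.
apply: (vsim_square Hh2 (LH Ly)); rewrite -yl /vsim.
have -> : h ^+ 2 + 1 - (l ^+ 2 + 1) = h ^+ 2 - l ^+ 2 by ring.
apply: (vlt_le_trans mP (vsimX mP 2 hl)) => -[l20]; apply: L_units.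
  by rewrite rpred_div ?rpredD ?rpredX ?rpred1.
by rewrite mulf_neq0 ?invr_eq0 ?sq_neqN1.
Qed.

End Pythagorean.

Section PythagoreanRealization.
Hypothesis L_npow : -1 \notin powers 2 L.
Hypothesis L_pyth : forall l, l \in L -> l ^+ 2 + 1 \in powers 2 L.
Variables (p_pr : prime 2) (I : choiceType) (c : I -> W) (D E : choiceType).
Variable f : D -> I + J.
Hypotheses (c_basis : basis_mod 2 [predI L & predC1 0] (powers 2 L) c) (f_bij : bijective f).

Lemma pythagorean_subfield : exists (H : divringClosed W) (b : D -> subfield_type H),
  [/\ forall d, inclusion H (b d) = sum_family c x (f d),
      basis_mod 2 (predC1 0) (powers 2 predT) b &
      forall y : subfield_type H, y ^+ 2 + 1 \in powers 2 predT].
Proof.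
have N1P := N1_primitive L_npow; have LN1 : -1 \in L by rewrite rpredN rpred1.
have [k [Lk xk domk]] := monomial_field_exists mP L_units x_neq0 x_indep predT.
have [H [kH GH maxH]] := maximal_monomial_field_exists Lk (fun j => xk j isT) domk.
have LH : {subset L <= H} by move=> l /Lk /kH.
have [bH bH_indep bH_span] : basis_mod 2 [predI H & predC1 0] (powers 2 H) (sum_family c x \o f).
  apply: (maximal_basis mP p_pr N1P maxH (LH _ LN1)
    (fun i => root_of_unity_separated N1P LN1) GH (monomial_group_neq0 _ _ _)).
    exact: monomial_group_lead.
  exact: (basis_mod_bij (monomial_group_neq0 L x_neq0 predT) f_bij
    (monomial_group_basis mP L_units x_neq0 x_indep _ c_basis)).
have bP d : sum_family c x (f d) \in H /\ sum_family c x (f d) != 0.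
  by have := bH d; rewrite !inE => /andP.
exists H, (fun d => Subfield (bP d).1); split=> // [|y]; last first.
  rewrite -powers_inclusion rmorphD rmorphXn rmorph1.
  exact: (pythagorean_maximal L_npow L_pyth LH maxH (mem_inclusion y)).
split=> [d||y y0]; first by rewrite inE -(fmorph_eq0 (inclusion H)); exact: (bP d).2.
  exact: indep_mod_inclusion.
by apply: span_mod_inclusion; apply: bH_span; rewrite !inE mem_inclusion fmorph_eq0.
Qed.

Lemma pythagorean_realizes i d : (E -> False) ->
  c i = -1 -> f d = inl i -> realizes p_pr D E 0.
Proof.
move=> E_empty ci fd; have [H [b [bE [b0 b_indep b_span] H_pyth]]] := pythagorean_subfield.
have bd : b d = -1 by apply: (fmorph_inj (inclusion H)); rewrite bE fd rmorphN1.
have N1_npow : -1 \notin powers 2 (predT : {pred subfield_type H}).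
  by rewrite -bd; exact: indep_mod_notin b_indep.
have N1HP : 2.-primitive_root (-1 : subfield_type H).
  rewrite -(fmorph_primitive_root (inclusion H)) rmorphN1.
  exact: N1_primitive L_npow.
have [K [cK normE]] := sum_of_squares_extension (inclusion H) N1HP N1_npow H_pyth.
have norm_sub y : y \in norm_image K -> y \in powers 2 predT.
  by move=> Ny; rewrite -normE // (norm_image_neq0 Ny).
have b_basis : basis_mod 2 (predC1 0) (norm_image K) b.
  split=> // [n /norm_sub/b_indep //|y y0]; have [n yn] := b_span y y0; exists n.
  by rewrite normE // mulf_neq0 ?invr_eq0 ?monomial_neq0.
have t : E -> subfield_type H by move=> e; case: (E_empty e).
exists (subfield_type H), (-1), K, cK; split=> //; first exact: d_space_dim b_basis.
  apply: (e_space_dim p_pr (t := t)); split=> [e|n _ e|y /norm_sub y2].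
  - by case: (E_empty e).
  - by case: (E_empty e).
  - by exists 0; rewrite monomial0 divr1.
by rewrite UpsilonE; apply/eqP; rewrite eqb0; apply: contra N1_npow; exact: norm_sub.
Qed.

End PythagoreanRealization.

Variables (p : nat) (xi : W).
Hypotheses (p_pr : prime p) (xiP : p.-primitive_root xi) (Lxi : xi \in L).

Let p_gt0 : (0 < p)%N := prime_gt0 p_pr.

(* The fields k, k(x j0) and F lie in H; the independence of the x j0 - r i over
   k(x j0) is inherited by F. *)
Lemma ramified_tower (j0 : J) (E : choiceType) (r : E -> W) :
    injective r -> (forall i, r i \in L) ->
  exists H F : divringClosed W,
    [/\ maximal_dominated m G H, {subset G <= H} /\ {subset F <= H},
        {subset L <= F} /\ (forall j, x j \in F),
        indep_mod p (powers p F) (fun i => x j0 - r i) &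
        forall y, y \in F -> y \in powers p H ->
          span_mod (powers p F) (fun i => x j0 - r i) y].
Proof.
move=> r_inj Lr; pose A : {pred J} := predC1 j0.
have [k [Lk xk domk]] := monomial_field_exists mP L_units x_neq0 x_indep A.
have j0A : j0 \notin A by rewrite !inE eqxx.
have x0_indep g i : g \in monomial_group L x_neq0 A -> (0 < i)%N ->
    m (g * x j0 ^+ i) \/ m (g * x j0 ^+ i)^-1 by exact: val_monomial_var.
have Gx0 : x j0 \in G by exact: var_monomial_group.
have GA : {subset monomial_group L x_neq0 A <= G} by exact: monomial_groupS.
have dom_k1 := dominated_adjoin mP (x_neq0 j0) domk x0_indep GA Gx0.
have kk1 := sub_adjoin (F := k) (x j0).
have Lk1 l : l \in L -> l \in adjoin k (x j0) by move=> /Lk /kk1.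
have xk1 j : x j \in adjoin k (x j0).
  by have [->|jj0] := eqVneq j j0; [exact: mem_adjoin | apply/kk1/xk].
have [H [k1H GH maxH]] := maximal_monomial_field_exists Lk1 xk1 dom_k1.
have x_transc f := dominated_transcendental mP (x_neq0 j0) domk x0_indep (f := f).
have T_indep := indep_mod_transcendental r_inj p_gt0 x_transc (fun i => Lk _ (Lr i)).
have T_neq0 i : x j0 - r i != 0.
  have := x_transc ('X - (r i)%:P); rewrite !hornerE; apply; last by rewrite polyXsubC_eq0.
  by rewrite rpredB ?polyOverX // polyOverC Lk.
have T_k1 i : x j0 - r i \in adjoin k (x j0) by rewrite rpredB ?xk1 // Lk1.
have [F [k1F FH F_indep F_span]] :=
  Kummer_maximal_subfield p_pr xiP (Lk1 _ Lxi) T_k1 T_neq0 k1H T_indep.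
by exists H, F; split=> //; split=> [l /Lk1 /k1F|j]; last exact: k1F.
Qed.

Section RamifiedRealization.
Variables (I : choiceType) (c : I -> W) (D E : choiceType) (e0 : E) (j0 : J).
Variables (f : unit + D -> I + J) (lab : E -> W).
Hypothesis c_basis : basis_mod p [predI L & predC1 0] (powers p L) c.
Hypotheses (f_bij : bijective f) (f_tt : f (inl tt) = inr j0).
Hypotheses (lab_L : forall i, lab i \in L) (lab_e0 : lab e0 = 0).
Hypothesis lab_inj : injective (fun i => lab i ^+ p).

Lemma ramified_bases : exists (F : divringClosed W) (xiF : subfield_type F)
    (K : splittingFieldType (subfield_type F)) (cK : cyclic_ext p K)
    (b : D -> subfield_type F) (t : E -> subfield_type F),
  [/\ {subset L <= F}, inclusion F xiF = xi,
      forall d, inclusion F (b d) = sum_family c x (f (inr d)),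
      basis_mod p (predC1 0) (norm_image K) b &
      basis_mod p (norm_image K) (powers p predT) t].
Proof.
have r_inj : injective (fun i => - lab i ^+ p) by move=> i i' /oppr_inj/lab_inj.
have Lr i : - lab i ^+ p \in L by rewrite rpredN rpredX.
have [H [F [maxH [GH FH] [LF xF] T_indep T_span]]] := ramified_tower j0 r_inj Lr.
have sF s : sum_family c x s \in F.
  by case: s => [i|j] //=; apply: LF; have [/(_ i)] := c_basis; rewrite inE => /andP[].
have tF i : x j0 + lab i ^+ p \in F by rewrite rpredD // LF // rpredX.
pose b s : subfield_type F := Subfield (sF (f s)).
pose t i : subfield_type F := Subfield (tF i).
pose lF i : subfield_type F := Subfield (LF _ (lab_L i)).
pose xiF : subfield_type F := Subfield (LF _ Lxi).
have xiFP : p.-primitive_root xiF by rewrite -(fmorph_primitive_root (inclusion F)).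
have b_basis : basis_mod p G (powers p G) (inclusion F \o b).
  exact: (basis_mod_bij (monomial_group_neq0 L x_neq0 predT) f_bij
    (monomial_group_basis mP L_units x_neq0 x_indep p_gt0 c_basis)).
have b_tt : inclusion F (b (inl tt)) = x j0 by rewrite /= f_tt.
have tE i : t i = lF i ^+ p + b (inl tt).
  by apply: val_inj; rewrite [RHS](rmorphD (inclusion F)) rmorphXn b_tt /= addrC.
have lF_e0 : lF e0 = 0 by apply: val_inj.
have tT : inclusion F \o t = (fun i => x j0 - - lab i ^+ p).
  by apply/funext => i /=; rewrite opprK.
have t_indep : indep_mod p (powers p predT) t by apply: indep_mod_inclusion; rewrite tT.
have [|||K [cK [b_norm t_norm]]] := ramified_extension (iota := inclusion F) mP p_pr xiFP maxH _ GH
  (monomial_group_neq0 _ _ _) (monomial_group_lead mP L_units x_indep (A := predT))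
  (fun i => root_of_unity_separated xiP Lxi) b_basis tE lF_e0 t_indep.
- by move=> y; apply/FH/mem_inclusion.
- move=> y Hy; apply: span_mod_inclusion; rewrite tT.
  by apply: T_span => //; exact: mem_inclusion.
- move=> g i Gg ip; rewrite rmorphN b_tt -mulN1r.
  apply: (val_monomial_ramified mP L_units x_indep j0 _ _ Gg ip).
    by rewrite rpredN rpred1.
  by rewrite oppr_eq0 oner_eq0.
by exists F, xiF, K, cK, (b \o inr), t; split.
Qed.

Lemma ramified_realizes_norm : xi \in powers p L -> realizes p_pr D E 1.
Proof.
move=> /powersP[y Ly xiy].
have [F [xiF [K [cK [b [t [LF xiE bE b_norm t_norm]]]]]]] := ramified_bases.
exists (subfield_type F), xiF, K, cK; split.
- by rewrite -(fmorph_primitive_root (inclusion F)) xiE.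
- exact: d_space_dim b_norm.
- exact: e_space_dim t_norm.
have y0 : y != 0.
  by apply: contra_eq_neq xiy => ->; rewrite expr0n gtn_eqF // (prim_root_eq0 xiP) -lt0n.
have -> : xiF = Subfield (LF _ Ly) ^+ p.
  by apply: val_inj; rewrite [LHS]xiE [RHS](rmorphXn (inclusion F)).
by rewrite UpsilonE norm_image_exp //; apply: contra_neq y0 => /(congr1 (inclusion F)).
Qed.

Lemma ramified_realizes_nonnorm i d :
  c i = xi -> f (inr d) = inl i -> realizes p_pr D E 0.
Proof.
move=> ci fd; have [F [xiF [K [cK [b [t [LF xiE bE b_norm t_norm]]]]]]] := ramified_bases.
exists (subfield_type F), xiF, K, cK; split.
- by rewrite -(fmorph_primitive_root (inclusion F)) xiE.
- exact: d_space_dim b_norm.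
- exact: e_space_dim t_norm.
have -> : xiF = b d by apply: (fmorph_inj (inclusion F)); rewrite xiE bE fd.
have [_ b_indep _] := b_norm.
by rewrite UpsilonE (negPf (indep_mod_notin d (prime_gt1 p_pr) b_indep)).
Qed.

End RamifiedRealization.
End ValuedMonomials.

(** * Fields of constants *)

Definition whole_field (W : fieldType) : divringClosed W :=
  @subfield_of W predT (And3 isT (fun _ _ _ _ => isT) (fun _ _ _ _ => isT)).

Lemma whole_field_basis (W : closedFieldType) p : (0 < p)%N ->
  basis_mod p [predI whole_field W & predC1 0] (powers p (whole_field W)) (@of_void W).
Proof.
move=> p_gt0; split=> [[]|n _ []|y _]; exists 0; rewrite monomial0 divr1.
by have [g gy] := closed_field_root y p_gt0; apply/powersP; exists g.
Qed.

Definition real_algebraics : divringClosed algC :=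
  GRing.DivringClosed.clone algC Num.Def.real_num_pred _.

Lemma real_algebraicsE z : (z \in real_algebraics) = (z \is Num.real).
Proof. by []. Qed.

Lemma nneg_square z : 0 <= z -> z \in powers 2 real_algebraics.
Proof.
move=> z0; apply/powersP; exists (sqrtC z); last by rewrite sqrtCK.
by rewrite real_algebraicsE ger0_real // sqrtC_ge0.
Qed.

Lemma real_square_nneg z : z \in powers 2 real_algebraics -> 0 <= z.
Proof. by move=> /powersP[y yr ->]; rewrite real_exprn_even_ge0. Qed.

Lemma real_algebraics_basis :
  basis_mod 2 [predI real_algebraics & predC1 0] (powers 2 real_algebraics)
    (fun _ : unit => -1).
Proof.
split=> [_||y].
- by rewrite !inE rpredN rpred1 oppr_eq0 oner_eq0.
- apply: indep_mod_unit; rewrite // ?oppr_eq0 ?oner_eq0 ?mem_powers ?rpredN ?rpred1 //.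
  by apply/negP => /real_square_nneg; rewrite oppr_ge0 ler10.
rewrite inE => /andP[yr _]; have [y0|y0] := real_ge0P yr.
  by exists 0; rewrite monomial0 divr1 nneg_square.
by exists << tt >>; rewrite monomialU expr1z invrN1 mulrN1 nneg_square // oppr_ge0 ltW.
Qed.

Lemma real_algebraics_pythagorean z :
  z \in real_algebraics -> z ^+ 2 + 1 \in powers 2 real_algebraics.
Proof. by move=> zr; apply: nneg_square; rewrite addr_ge0 ?ler01 // real_exprn_even_ge0. Qed.

Section NonPowerConstants.
Variables (p : nat) (p_pr : prime p) (xi : algC) (xiP : p.-primitive_root xi).

Let p_gt0 : (0 < p)%N := prime_gt0 p_pr.

(* An automorphism raising the roots of unity of order p^2 to the power p + 1
   fixes xi but not its p-th roots. *)
Lemma nonpower_subfield : exists F : divringClosed algC, xi \in F /\ xi \notin powers p F.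
Proof.
have cop : coprime p.+1 (p ^ 2) by rewrite coprimeXr // coprimeSn.
have [u uP] := Qn_aut_exists cop.
have fix_closed : divring_closed [pred z | u z == z].
  split=> [|y z|y z]; rewrite !inE ?rmorph1 //.
    by move=> /eqP uy /eqP uz; rewrite rmorphB uy uz.
  by move=> /eqP uy /eqP uz; rewrite fmorph_div uy uz.
exists (subfield_of fix_closed); split.
  rewrite [_ \in _](_ : _ = (u xi == xi)) //; apply/eqP.
  by rewrite uP ?expnS ?expn1 ?exprM ?(prim_expr_order xiP) ?expr1n //
    exprS (prim_expr_order xiP) mulr1.
apply/negP => /powersP[g /eqP ug xig]; move: ug; rewrite uP; last first.
  by rewrite expnS expn1 exprM -xig (prim_expr_order xiP).
have g0 : g != 0.
  have : xi != 0 by rewrite (prim_root_eq0 xiP) -lt0n.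
  by rewrite xig expf_eq0 p_gt0.
rewrite exprS -xig -[X in _ = X]mulr1 => /(mulfI g0) xi1.
have := prim_order_dvd xiP 1; rewrite expr1 xi1 eqxx dvdn1 => /eqP p1.
by have := prime_gt1 p_pr; rewrite p1.
Qed.

Lemma nonpower_constants : exists k0 : divringClosed algC, xi \in k0 /\
  basis_mod p [predI k0 & predC1 0] (powers p k0) (fun _ : unit => xi).
Proof.
have [F [Fxi F_npow]] := nonpower_subfield.
have xi0 : xi != 0 by rewrite (prim_root_eq0 xiP) -lt0n.
have F_indep : indep_mod p (powers p F) (fun _ : unit => xi).
  by apply: indep_mod_unit; rewrite ?mem_powers.
have sub : {subset F <= whole_field algC} by [].
have [k0 [Fk0 _ k0_indep k0_span]] :=
  Kummer_maximal_subfield p_pr xiP Fxi (fun=> Fxi) (fun=> xi0) sub F_indep.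
exists k0; split; first exact: Fk0.
split=> [_|//|y]; first by rewrite inE /= Fk0.
rewrite inE => /andP[Ly _]; apply: k0_span => //.
by have [g gy] := closed_field_root y p_gt0; apply/powersP; exists g.
Qed.

End NonPowerConstants.

(** * Existence *)

Lemma realizes_norm p (p_pr : prime p) (D E : choiceType) (e0 : E) :
  realizes p_pr D E 1.
Proof.
have [U [UU FU]] := ultraFilterLemma (scale_filter_proper E (unit + D)%type).
have p_gt0 := prime_gt0 p_pr; have [xi xiP] := C_prim_root_exists p_gt0.
have xiWP : p.-primitive_root (ultra_const UU xi) by rewrite fmorph_primitive_root.
have Lconst (a : algC) : ultra_const UU a \in slow_field (whole_field algC).
  exact: const_slow_field.
have f_bij : bijective (inr : unit + D -> void + (unit + D)).
  by exists (fun s => match s with inl v => of_void _ v | inr t => t end) => // -[[]|].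
apply: (ramified_realizes_norm (infinitesimal_val UU) (@slow_field_units _ _ _ UU _)
  (variable_neq0 UU FU) (variable_indep UU FU) p_pr xiWP (Lconst xi)
  (slow_field_basis UU p_gt0 (whole_field_basis algC p_gt0)) f_bij erefl
  (label_slow_field UU e0 (whole_field algC)) (label_e0 UU e0) (label_exp_inj FU p_gt0)).
have [y yp] := closed_field_root xi p_gt0.
by rewrite -yp rmorphXn; apply/mem_powers/Lconst.
Qed.

Lemma realizes_nonnorm p (p_pr : prime p) (D E : choiceType) (d0 : D) (e0 : E) :
  realizes p_pr D E 0.
Proof.
have [U [UU FU]] := ultraFilterLemma (scale_filter_proper E D).
have p_gt0 := prime_gt0 p_pr; have [xi xiP] := C_prim_root_exists p_gt0.
have [k0 [k0xi xi_basis]] := nonpower_constants p_pr xiP.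
have xiWP : p.-primitive_root (ultra_const UU xi) by rewrite fmorph_primitive_root.
pose f (s : unit + D) : unit + D :=
  match s with inl _ => inr d0 | inr d => if d == d0 then inl tt else inr d end.
have f_bij : bijective f.
  by exists f => -[[]|d] /=; rewrite ?eqxx //; case: eqVneq => [->|/negPf] //= ->.
apply: (ramified_realizes_nonnorm (infinitesimal_val UU) (@slow_field_units _ _ _ UU _)
  (variable_neq0 UU FU) (variable_indep UU FU) p_pr xiWP (const_slow_field UU k0xi)
  (slow_field_basis UU p_gt0 xi_basis) f_bij erefl
  (label_slow_field UU e0 k0) (label_e0 UU e0) (label_exp_inj FU p_gt0) (i := tt) (d := d0)) => //=.
by rewrite eqxx.
Qed.

Lemma realizes_real (p_pr : prime 2) (D E : choiceType) (d0 : D) :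
  (E -> False) -> realizes p_pr D E 0.
Proof.
move=> E_empty; pose J := {d : D | d != d0}.
have [U [UU FU]] := ultraFilterLemma (scale_filter_proper E J).
pose f (d : D) : unit + J := if insub d is Some j then inr j else inl tt.
have fE d : f d = if insub d is Some j then inr j else inl tt by [].
have fd0 : f d0 = inl tt by rewrite fE insubF // eqxx.
have f_bij : bijective f.
  exists (fun s => if s is inr j then val j else d0) => [d|[[]|j]]; rewrite ?fd0 //.
    by rewrite fE; case: insubP => [j _ <-//|/negPn/eqP].
  by rewrite fE valK.
have constN1 : ultra_const UU (-1 : algC) = -1 by rewrite rmorphN1.
have N1_npow : -1 \notin powers 2 (slow_field (UU := UU) real_algebraics).
  rewrite -constN1; apply: contraTN isT => /const_powers/real_square_nneg.
  by rewrite oppr_ge0 ler10.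
exact: (pythagorean_realizes (infinitesimal_val UU) (@slow_field_units _ _ _ UU _)
  (variable_neq0 UU FU) (variable_indep UU FU) N1_npow
  (slow_field_pythagorean real_algebraics_pythagorean) p_pr
  (slow_field_basis UU (ltn0Sn 1) real_algebraics_basis) f_bij E_empty constN1 fd0).
Qed.

(** * Necessary conditions *)

Lemma has_dim_empty (k : fieldType) (V : lmodType k) (I : Type) :
  has_dim V I -> ~ inhabited I -> forall v : V, v = 0.
Proof.
move=> [b [_ b_span]] I_empty v; have [[|n] [s [c ->]]] := b_span v.
  exact: big_ord0.
by case: I_empty; exact: (inhabits (s ord0)).
Qed.

Section Necessity.
Variables (F : fieldType) (K : splittingFieldType F) (p : nat) (p_pr : prime p).
Variables (cK : cyclic_ext p K).

Let p_gt0 : (0 < p)%N := prime_gt0 p_pr.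

Lemma d_space_inhabited (D : Type) (y : F) :
  has_dim (d_space p_pr cK) D -> y != 0 -> y \notin norm_image K -> inhabited D.
Proof.
move=> dimD y0 nNy; apply: contrapT => /(has_dim_empty dimD) class_eq0.
case/negP: nNy; rewrite -[y]/(uval (Units y0)) -mem_norms -[Units y0]subr0.
by rewrite Quotient.idealrBE raddf0; apply/eqP/class_eq0.
Qed.

Lemma e_space_inhabited (E : Type) (y : F) :
  has_dim (e_space K p_pr) E -> y \in norm_image K -> y \notin powers p predT ->
  inhabited E.
Proof.
move=> dimE Ny y_npow; apply: contrapT => /(has_dim_empty dimE) class_eq0.
have Nu : Units (norm_image_neq0 Ny) \in norms K by rewrite mem_norms.
have /asboolP[u yu] : NormGroup Nu \in pth_powers p.
  by rewrite -[NormGroup Nu]subr0 Quotient.idealrBE raddf0; apply/eqP/class_eq0.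
by case/negP: y_npow; rewrite -[y]/(uval (NormGroup Nu)) yu uvalMn mem_powers.
Qed.

Variables (xi : F) (xiP : p.-primitive_root xi).

Lemma Kummer_generator_exists : exists (z : K) (a : F), z \notin 1%VS /\ z ^+ p = a%:A.
Proof.
have [_ /cyclicP[s s_gen] _] := cK.
have sG : s \in 'Gal({:K} / 1)%g by rewrite s_gen cycle_id.
have xi0 : xi != 0 by rewrite (prim_root_eq0 xiP) -lt0n.
have xi1 : xi != 1.
  by rewrite -[xi]expr1 -(prim_order_dvd xiP) dvdn1 neq_ltn prime_gt1 ?orbT.
have s1 : s != 1%g.
  by rewrite -order_eq1 orderE -s_gen (card_gal_cyclic_ext cK) neq_ltn prime_gt1 ?orbT.
have s_generator : generator 'Gal({:K} / 1) s by rewrite /generator s_gen.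
have [|z [_ z0] zE] := elimT (Hilbert's_theorem_90 (a := (xi^-1)%:A) s_generator (memvf _)).
  by rewrite (galNorm_alg cK) exprVn (prim_expr_order xiP) invr1 scale1r.
have sz : s z = xi%:A * z.
  have sz0 : s z != 0 by rewrite fmorph_eq0.
  by rewrite -[z in RHS](divfK sz0) -zE mulrA -!in_algE -rmorphM mulfV // rmorph1 mul1r.
have [|a za] := fixed_cyclic_ext p_pr cK (w := z ^+ p) sG s1.
  rewrite rmorphXn /= sz exprMn -in_algE -rmorphXn (prim_expr_order xiP) rmorph1.
  exact: mul1r.
exists z, a; split=> //; apply: contraNN xi1 => /(fixed_gal (sub1v _) sG).
by rewrite sz -[RHS]mul1r => /(mulIf z0)/eqP; rewrite -in_algE fmorph_eq1.
Qed.

Lemma norm_not_power : -1 \in norm_image K ->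
  exists2 y, y \in norm_image K & y \notin powers p predT.
Proof.
move=> NN1; have [z [a [z1 za]]] := Kummer_generator_exists.
exists a; last first.
  apply: contra z1 => /powersP[y _ ay]; apply/vlineP.
  by apply: (root_of_exp xiP (y := y)); rewrite za ay.
have z0 : z != 0 by apply: contraNneq z1 => ->; exact: mem0v.
have Na : - a \in norm_image K.
  apply/norm_imageP; exists (0%:A - z); first by rewrite scale0r sub0r oppr_eq0.
  by rewrite (galNorm_sub p_pr cK za z1) expr0n gtn_eqF // sub0r.
by rewrite -[a]opprK -mulN1r rpredM.
Qed.

Lemma norm_imageN1 : (p = 2%N -> xi \in norm_image K) -> -1 \in norm_image K.
Proof.
have [p_eq2|p_odd _] := even_prime p_pr; last first.
  have := norm_image_exp cK (c := -1).
  by rewrite -signr_odd p_odd; apply; rewrite oppr_eq0 oner_eq0.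
move: xiP; rewrite p_eq2 => xi2P /(_ erefl); suff -> : xi = -1 by [].
have /eqP := prim_expr_order xi2P; rewrite sqrf_eq1 => /orP[|/eqP//].
by rewrite -[xi]expr1 -(prim_order_dvd xi2P).
Qed.

End Necessity.

Local Open Scope classical_set_scope.
Local Open Scope card_scope.

Lemma card_ge1 (T : Type) : `I_1 #<= [set: T] <-> inhabited T.
Proof.
split=> [|[t]]; last by rewrite -(card_le_eql (card_set1 (x := t))) subset_card_le.
apply: contraPP => T_empty; rewrite (_ : [set: T] = set0) ?card_le0.
  by move=> /eqP/seteqP[/(_ 0%N) I1_empty _]; exact: I1_empty.
by apply/seteqP; split=> // t _; case: T_empty.
Qed.

Theorem theorem1 (p : nat) (p_pr : prime p) (D E : Type) (Y : nat)
    (Y01 : Y = 0%N \/ Y = 1%N) :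
  (exists (F : fieldType) (xi : F) (K : splittingFieldType F)
     (cK : cyclic_ext p K),
     [/\ p.-primitive_root xi, has_dim (d_space p_pr cK) D,
         has_dim (e_space K p_pr) E & Upsilon K xi = Y])
  <->
  [/\ Y = 0%N -> `I_1 #<= [set: D],
      (2 < p)%N -> `I_1 #<= [set: E] &
      p = 2%N /\ Y = 1%N -> `I_1 #<= [set: E]].
Proof.
have p2 : (2 < p)%N \/ p = 2%N.
  by have := prime_gt1 p_pr; rewrite leq_eqVlt => /predU1P[|]; [right | left].
split=> [[F [xi [K [cK [xiP dimD dimE <-]]]]]|[D_ge1 E_ge1 E_ge1_2]].
  have E_ge1 : (p = 2%N -> xi \in norm_image K) -> `I_1 #<= [set: E].
    move=> /(norm_imageN1 p_pr cK xiP)/(norm_not_power p_pr cK xiP)[y Ny y_npow].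
    exact/card_ge1/(e_space_inhabited dimE Ny y_npow).
  rewrite UpsilonE; split=> [/eqP|p_gt2|[_ xiN]].
  - rewrite eqb0 => xiN; apply/card_ge1/(d_space_inhabited dimD _ xiN).
    by rewrite (prim_root_eq0 xiP) -lt0n prime_gt0.
  - by apply: E_ge1 => p_eq2; rewrite p_eq2 in p_gt2.
  - by apply: E_ge1 => _; apply: contra_eqT xiN => /negPf ->.
case: Y01 => Y_eq; rewrite {}Y_eq in D_ge1 E_ge1_2 *.
  have /card_ge1[d0] := D_ge1 erefl.
  have [[e0]|E_empty] := pselect (inhabited E).
    exact: (@realizes_nonnorm p p_pr {classic D} {classic E} d0 e0).
  case: p2 => [/E_ge1/card_ge1 //|p_eq2]; case: _ / (esym p_eq2) in p_pr *.
  exact: (@realizes_real p_pr {classic D} {classic E} d0 (fun e => E_empty (inhabits e))).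
have /card_ge1[e0] : `I_1 #<= [set: E] by case: p2 => [/E_ge1 //|p_eq2]; apply: E_ge1_2.
exact: (@realizes_norm p p_pr {classic D} {classic E} e0).
Qed.
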